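(* Let $\mathcal{H}$ be a separable Hilbert space and $\rho$ an arbitrary state in $\mathfrak{S}(\mathcal{H})$. For $\varepsilon\in(0,1]$ put $$L_S(\rho|\varepsilon)=\inf\left\{S(\sigma)\,:\,\sigma\in\mathfrak{S}(\mathcal{H}),\ \tfrac12\|\rho-\sigma\|_1\le\varepsilon\right\}.$$ Then $$L_S(\rho|\varepsilon)\ge S([\rho-\varepsilon I_{\mathcal{H}}]_+)-g(\varepsilon)\qquad\text{(i)}$$ for any $\varepsilon\in(0,1]$, where $[\rho-\varepsilon I_{\mathcal{H}}]_+$ is the positive part of the operator $\rho-\varepsilon I_{\mathcal{H}}$ and $S(\cdot)$ on the right is the extended von Neumann entropy. If $\rho$ is a state with finite entropy $S(\rho)$ then $$L_S(\rho|\varepsilon)\ge S(\rho)-S(\rho\wedge\varepsilon I_{\mathcal{H}})-g(\varepsilon)\qquad\text{(ii)}$$ for any $\varepsilon\in(0,1]$. The lower bounds (i) and (ii) are faithful: their right hand sides tend to $S(\rho)\le+\infty$ as $\varepsilon\to0$.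
   Context: $\mathfrak{S}(\mathcal{H})$ is the set of quantum states (positive trace-class operators with unit trace), $\|\cdot\|_1$ the trace norm, $I_{\mathcal{H}}$ the identity. The von Neumann entropy of a state is $S(\rho)=\operatorname{Tr}\eta(\rho)\in[0,+\infty]$, $\eta(x)=-x\ln x$ for $x>0$, $\eta(0)=0$. It is extended to all positive trace-class operators by $S(\rho)=(\operatorname{Tr}\rho)S(\rho/\operatorname{Tr}\rho)=\operatorname{Tr}\eta(\rho)-\eta(\operatorname{Tr}\rho)$ for $\rho\ne0$, and $S(0)=0$. $g(x)=(x+1)\ln(x+1)-x\ln x$ for $x>0$, $g(0)=0$. For $\rho=\sum_i\lambda_i^\rho|\varphi_i\rangle\langle\varphi_i|$ (spectral representation): $\rho\wedge\varepsilon I_{\mathcal{H}}=\sum_i\min\{\lambda_i^\rho,\varepsilon\}|\varphi_i\rangle\langle\varphi_i|$ and $[\rho-\varepsilon I_{\mathcal{H}}]_+=\sum_i\max\{\lambda_i^\rho-\varepsilon,0\}|\varphi_i\rangle\langle\varphi_i|$. *)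

(* Defs.v *)
From HB Require Import structures.
From mathcomp Require Import all_boot all_order all_algebra.
From mathcomp Require Import all_classical all_reals all_analysis.
From mathcomp Require Import complex sesquilinear.
Import Order.TTheory GRing.Theory Num.Theory.
Import numFieldNormedType.Exports.

Set Implicit Arguments.
Unset Strict Implicit.
Unset Printing Implicit Defensive.

Local Open Scope classical_set_scope.
Local Open Scope ring_scope.
Local Open Scope complex_scope.

Section Functions.
Context {R : realType}.
Implicit Types x : R.

(* The values at 0 come out right for any value of ln 0, as 0 * ln 0 = 0. *)
Definition eta x : R := - (x * ln x).

Definition gfun x : R := (x + 1) * ln (x + 1) - x * ln x.

End Functions.

Definition separable (T : topologicalType) : Prop :=
  exists2 D : set T, countable D & dense D.

Section Operators.
Context {R : realType} {H : completeNormedModType R[i]}.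

(* Linear in the first argument and conjugate-linear in the second one. *)
Variable dot : {dot H for (@Num.conj R[i])}.

(* H being complete, the norm being that of dot makes H a Hilbert space. *)
Definition hilbert : Prop := forall x : H, `|x| ^+ 2 = dot x x.

Implicit Types A B : H -> H.

Definition bounded_op A : Prop := linear A /\ continuous A.

(* The order of R[i] makes this say that dot (A x) x is real and >= 0. *)
Definition positive_op A : Prop := forall x, 0 <= dot (A x) x.

(* Operators determined by a property are picked by xget; the value (fun=> 0)
   is a junk value, returned only if no operator has the property. *)
Definition adjoint A : H -> H :=
  xget (fun=> 0)
    [set B | bounded_op B /\ forall x y, dot (A x) y = dot x (B y)].

Definition abs_op A : H -> H :=
  xget (fun=> 0)
    [set B | [/\ bounded_op B, positive_op B & B \o B = adjoint A \o A]].

(* A maximal orthonormal set, of any cardinality. *)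
Definition orthonormal_basis (E : set H) : Prop :=
  (forall u v, E u -> E v -> dot u v = (u == v)%:R) /\
  (forall x, (forall u, E u -> dot x u = 0) -> x = 0).

(* The trace of a positive operator, in [0, +oo]; it does not depend on the
   orthonormal basis which is picked. Meaningless for other operators. *)
Definition trace A : \bar R :=
  \esum_(u in xget set0 orthonormal_basis) (complex.Re (dot (A u) u))%:E.

Definition trace_norm A : \bar R := trace (abs_op A).

Definition trace_class A : Prop := bounded_op A /\ (trace_norm A < +oo)%E.

Definition state A : Prop :=
  [/\ trace_class A, positive_op A & trace A = 1%E].

(* A = sum_i l_i |e_i><e_i|, strongly. The indices i with l i = 0 are mere
   padding, with e i unconstrained: this accounts for operators of finite
   rank, in particular when H has finite dimension, and leaves out the
   eigenvectors for the eigenvalue 0. *)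
Definition spectral_repr A (l : nat -> R) (e : nat -> H) : Prop :=
  (forall i j, l i != 0 -> l j != 0 -> dot (e i) (e j) = (i == j)%:R) /\
  (forall x, (\sum_(i < n) ((l i)%:C * dot x (e i)) *: e i) @[n --> \oo]
     --> A x).

(* f(A) = sum_i f(l_i) |e_i><e_i|, to be used with f 0 = 0 only. *)
Definition fun_op (f : R -> R) A : H -> H :=
  xget (fun=> 0)
    [set B | exists l e, spectral_repr A l e /\ spectral_repr B (f \o l) e].

Definition min_op A (eps : R) : H -> H := fun_op (fun x => Num.min x eps) A.

Definition pos_part_sub A (eps : R) : H -> H :=
  fun_op (fun x => Num.max (x - eps) 0) A.

Definition state_entropy A : \bar R := trace (fun_op eta A).

Definition normalized A : H -> H := fun x => ((fine (trace A))^-1)%:C *: A x.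

Definition entropy A : \bar R :=
  if `[< A = (fun=> 0) >] then 0%E
  else (trace A * state_entropy (normalized A))%E.

Definition LS (rho : H -> H) (eps : R) : \bar R :=
  ereal_inf [set entropy sigma | sigma in
    [set sigma | state sigma /\
       ((2^-1)%:E * trace_norm (fun x => (rho x - sigma x)%R) <= eps%:E)%E]].

End Operators.

(* Main.v *)
(** Let p and q be the decreasingly ordered eigenvalues of rho and of a state
sigma with |rho - sigma|_1 / 2 <= eps. The operator G = (rho + sigma +
|rho - sigma|) / 2 dominates rho and sigma, since B >= 0 and B^2 = A^2 imply
A <= B, and its trace is at most 1 + eps. By Weyl's monotonicity its
eigenvalues r dominate p and q, whence the sum of (p_i - q_i)_+ is at most
eps. Everything then reduces to the extended Shannon entropy of sequences,
which is superadditive by Gibbs' inequality, hence monotone: (p - eps)_+ <= q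
gives (i); and with a = (p - q)_+, which is below both p and eps, the chain
S(p) <= S(q + a) <= S(q) + S(a) + g(sum a) gives (ii). The right hand side of
(i) tends to S(rho) by lower semicontinuity, and by superadditivity that of
(ii) lies between the right hand side of (i) and S(rho). *)

Require Import Defs.
From HB Require Import structures.
From mathcomp Require Import all_boot all_order all_algebra.
From mathcomp Require Import all_classical all_reals all_analysis.
From mathcomp Require Import complex sesquilinear.
From mathcomp Require Import ring lra.
Import Order.TTheory GRing.Theory Num.Theory.
Import numFieldNormedType.Exports.

Set Implicit Arguments.
Unset Strict Implicit.
Unset Printing Implicit Defensive.

Local Open Scope classical_set_scope.
Local Open Scope ring_scope.
Local Open Scope complex_scope.
Local Notation Re := complex.Re.
Local Notation Im := complex.Im.

(** * Sums of nonnegative extended reals *)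

Section Esum.
Context {R : realType}.
Local Open Scope ereal_scope.

(** The majorant G only controls (p - q)_+, not the sum of |p_i - q_i|; but both bounds need no
    more, and the control is immediate: r - q is nonnegative, dominates (p - q)_+ and sums to at
    most eps. Entropies may be infinite, so each comparison is written with nonnegative terms summed
    in [0, +oo].

    What remains is shaped by operators known only through a property. [abs_op] and [fun_op] choose
    some operator that has it, so existence has to be shown first, and uniqueness is not invoked for
    either: |rho - sigma| enters only through its positivity and its square, and sums over
    eigenvalues are shown not to depend on the spectral representation that was chosen. Existence
    rests on a spectral theorem derived from the finiteness of the trace, which stands in for
    compactness. It lists the eigenvalues in decreasing order, as Weyl's monotonicity requires. *)

Lemma esum_le_seq (T : choiceType) (D : set T) (a : T -> \bar R) (c : \bar R) :
  (forall s : seq T, uniq s -> (forall i, i \in s -> D i) -> \sum_(i <- s) a i <= c) ->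
  \esum_(i in D) a i <= c.
Proof.
move=> h; apply: ge_ereal_sup => _ [X [finX XD] <-].
rewrite fsbig_finite//=; apply: h; first exact: finmap.fset_uniq.
by move=> i; rewrite in_fset_set// inE => /XD.
Qed.

Lemma esum_ge_seq (T : choiceType) (D : set T) (a : T -> \bar R) (s : seq T) :
  uniq s -> (forall i, i \in s -> D i) -> \sum_(i <- s) a i <= \esum_(i in D) a i.
Proof.
move=> us sD; apply: esum_ge; exists [set` s].
  by split; [exact: finite_seq|move=> i /= /sD].
by rewrite fsbig_seq.
Qed.

Lemma esum_approx (T : choiceType) (D : set T) (a : T -> \bar R) (c : \bar R) :
  c < \esum_(i in D) a i ->
  exists s : seq T, [/\ uniq s, forall i, i \in s -> D i & c < \sum_(i <- s) a i].
Proof.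
move=> h; apply: contrapT => hn; move: h; apply/negP; rewrite -leNgt.
apply: esum_le_seq => s us sD; rewrite leNgt; apply/negP => hs.
by apply: hn; exists s.
Qed.

Lemma esum_mulr (T : choiceType) (D : set T) (a : T -> \bar R) (c : R) :
  (0 <= c)%R -> (forall i, D i -> 0 <= a i) ->
  \esum_(i in D) (c%:E * a i) = c%:E * \esum_(i in D) a i.
Proof.
(* One inequality is enough: used again with c^-1 and the family c a_i, it yields the converse. *)
have le (b : T -> \bar R) (k : R) : (0 <= k)%R -> (forall i, D i -> 0 <= b i) ->
    \esum_(i in D) (k%:E * b i) <= k%:E * \esum_(i in D) b i.
  move=> k0 b0; apply: esum_le_seq => s us sD.
  rewrite big_seq -ge0_sume_distrr; last by move=> i /sD/b0.
  apply: lee_wpmul2l; first by rewrite lee_fin.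
  by rewrite -big_seq; exact: esum_ge_seq.
move=> c0 a0; apply/eqP; rewrite eq_le le//=.
have [->|cN0] := eqVneq c 0%R.
  by rewrite mul0e esum_ge0// => i _; rewrite mul0e.
have {cN0}c0 : (0 < c)%R by rewrite lt_neqAle eq_sym cN0.
have := @le (fun i => c%:E * a i) c^-1%R; rewrite invr_ge0 (ltW c0).
move=> /(_ isT) h.
have {}h : \esum_(i in D) a i <= (c^-1)%:E * \esum_(i in D) (c%:E * a i).
  apply: le_trans (h _); last by move=> i /a0 ?; rewrite mule_ge0// lee_fin ltW.
  by apply: le_esum => i _; rewrite muleA -EFinM mulVf ?gt_eqF// mul1e.
apply: le_trans (lee_wpmul2l _ h) _; first by rewrite lee_fin ltW.
by rewrite muleA -EFinM mulfV ?gt_eqF// mul1e.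
Qed.

Lemma esum_exchange (T1 T2 : choiceType) (I : set T1) (J : set T2)
    (a : T1 -> T2 -> \bar R) :
  (forall i j, I i -> J j -> 0 <= a i j) ->
  \esum_(i in I) \esum_(j in J) a i j = \esum_(j in J) \esum_(i in I) a i j.
Proof.
move=> a0; rewrite esum_esum// esum_esum; last by move=> i j Ji Ij; exact: a0.
rewrite (@reindex_esum _ _ _ (J `*`` (fun=> I)) _ (fun k => (k.2, k.1)))//.
split => [[j i]/= [Jj Ii]//|[j i] [j' i'] _ _ [-> ->]//|[i j] [/= Ii Jj]].
by exists (j, i).
Qed.

Lemma esum_nat_lt (a : nat -> R) (c : \bar R) : (forall i, (0 <= a i)%R) ->
  c < \esum_(i in [set: nat]) (a i)%:E -> exists n, c < (\sum_(i < n) a i)%:E.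
Proof.
move=> a0 /esum_approx[s [us _ hs]]; exists (\max_(i <- s) i.+1)%N.
apply: (lt_le_trans hs); rewrite sumEFin lee_fin.
rewrite -(big_mkord xpredT a) [leRHS](bigID (mem s)) /=.
rewrite [X in (_ <= X + _)%R](_ : _ = \sum_(i <- s) a i)%R.
  by rewrite lerDl sumr_ge0.
rewrite -big_filter; apply: perm_big; apply: uniq_perm => //.
  by rewrite filter_uniq// iota_uniq.
move=> i; rewrite mem_filter mem_index_iota leq0n /= andbC.
case: (boolP (i \in s)) => si; last by rewrite andbF.
by rewrite andbT (big_rem i si) /= leq_maxl.
Qed.

Lemma esum_ge_ord (a : nat -> R) n : (forall i, (0 <= a i)%R) ->
  (\sum_(i < n) a i)%:E <= \esum_(i in [set: nat]) (a i)%:E.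
Proof.
move=> a0; rewrite -(big_mkord xpredT a) -sumEFin.
by apply: esum_ge_seq => //; exact: iota_uniq.
Qed.

Lemma esum_le_ord (a : nat -> R) (c : \bar R) : (forall i, (0 <= a i)%R) ->
  (forall n, (\sum_(i < n) a i)%:E <= c) ->
  \esum_(i in [set: nat]) (a i)%:E <= c.
Proof.
move=> a0 h; rewrite leNgt; apply/negP => /esum_nat_lt[//|n].
by rewrite ltNge h.
Qed.

Lemma esum_term (T : choiceType) (D : set T) (a : T -> \bar R) i : D i ->
  a i <= \esum_(i in D) a i.
Proof.
by move=> Di; have := @esum_ge_seq _ D a [:: i]; rewrite big_seq1; apply => // j; rewrite inE => /eqP->.
Qed.

End Esum.

(** * Extended Shannon entropy of sequences *)

Section ClassicalEntropy.
Context {R : realType}.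
Implicit Types x y w p q a : nat -> R.

(** In contrast with [eta x], this is nonnegative for all 0 <= x <= t, even when t > 1. Sums of such
    terms make sense in [0, +oo], and no difference of infinities arises. *)
Definition shannon_term (t x : R) : R := x * (ln t - ln x).

(* For the sum t of l this is the extended Shannon entropy
   sum_i eta (l i) - eta t. *)
Definition shannon (t : R) (l : nat -> R) : \bar R :=
  \esum_(i in [set: nat]) (shannon_term t (l i))%:E.

Definition sums_to (l : nat -> R) (t : R) : Prop :=
  (forall i, 0 <= l i) /\ \esum_(i in [set: nat]) (l i)%:E = t%:E.

Lemma ler_ln_pos (u v : R) : 0 < u -> u <= v -> ln u <= ln v.
Proof. by move=> u0 uv; rewrite ler_ln// posrE// (lt_le_trans u0). Qed.

Lemma shannon_term0 t : shannon_term t 0 = 0. Proof. by rewrite /shannon_term mul0r. Qed.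

Lemma shannon_term_ge0 t u : 0 <= u -> u <= t -> 0 <= shannon_term t u.
Proof.
move=> u0 ut; have [->|un] := eqVneq u 0; first by rewrite shannon_term0.
have up : 0 < u by rewrite lt_neqAle eq_sym un.
by rewrite mulr_ge0// subr_ge0 ler_ln_pos.
Qed.

Lemma sums_to_ge0 l t : sums_to l t -> 0 <= t.
Proof. by move=> [l0 lt]; rewrite -lee_fin -lt esum_ge0// => i _; rewrite lee_fin. Qed.

Lemma sums_to_le l t i : sums_to l t -> l i <= t.
Proof. by move=> [l0 lt]; rewrite -lee_fin -lt; exact: esum_term. Qed.

Lemma sums_to_ord_le l t n : sums_to l t -> \sum_(i < n) l i <= t.
Proof. by move=> [l0 lt]; rewrite -lee_fin -lt; exact: esum_ge_ord. Qed.

Lemma shannon_ge0 l t : sums_to l t -> (0 <= shannon t l)%E.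
Proof.
move=> lt; apply: esum_ge0 => i _; rewrite lee_fin.
by rewrite shannon_term_ge0 ?(sums_to_le _ lt)//; case: lt.
Qed.

Lemma esum0_eq0 l : sums_to l 0 -> forall i, l i = 0.
Proof.
by move=> l0 i; apply/eqP; rewrite eq_le (sums_to_le i l0) (l0.1 i).
Qed.

Lemma sums_to_dominated x w t : (forall i, 0 <= x i <= w i) -> sums_to w t ->
  exists2 s, sums_to x s & 0 <= s <= t.
Proof.
move=> xw [w0 wt].
have x0 i : 0 <= x i by case/andP: (xw i).
have le : (\esum_(i in [set: nat]) (x i)%:E <= t%:E)%E.
  by rewrite -wt; apply: le_esum => i _; rewrite lee_fin; case/andP: (xw i).
have ge : (0 <= \esum_(i in [set: nat]) (x i)%:E)%E.
  by apply: esum_ge0 => i _; rewrite lee_fin.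
have fin : \esum_(i in [set: nat]) (x i)%:E \is a fin_num.
  by rewrite ge0_fin_numE// (le_lt_trans le)// ltry.
exists (fine (\esum_(i in [set: nat]) (x i)%:E)); first by split; rewrite ?fineK.
by rewrite -!lee_fin fineK// ge.
Qed.

Lemma sums_toD x y s t : sums_to x s -> sums_to y t ->
  sums_to (fun i => x i + y i) (s + t).
Proof.
move=> [x0 xs] [y0 yt]; split=> [i|]; first by rewrite addr_ge0.
by under eq_esum do rewrite EFinD; rewrite esumD ?xs ?yt// => i _; rewrite lee_fin.
Qed.

Lemma sums_to_uniq x s t : sums_to x s -> sums_to x t -> s = t.
Proof. by move=> [_ xs] [_]; rewrite xs => -[]. Qed.

Lemma sums_toB x w s t : (forall i, x i <= w i) -> sums_to x s -> sums_to w t ->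
  sums_to (fun i => w i - x i) (t - s).
Proof.
move=> xw xs wt.
have [i|d ds _] := @sums_to_dominated (fun i => w i - x i) w t _ wt.
  by rewrite subr_ge0 xw lerBlDr lerDl xs.1.
have e : (fun i => x i + (w i - x i)) = w by apply/funext => i; ring.
have := sums_toD xs ds; rewrite e => /(sums_to_uniq wt) ->.
by rewrite addrC addKr.
Qed.

(* ln u <= u - 1 at u = s y / (t x). *)
Lemma gibbs_term (s t x y : R) : 0 < s -> 0 < t -> 0 <= x -> 0 <= y ->
  (0 < x -> 0 < y) -> shannon_term s x + x <= x * (ln t - ln y) + s / t * y.
Proof.
move=> s0 t0 x0 y0 xy; have [->|xn] := eqVneq x 0.
  by rewrite shannon_term0 mul0r !add0r mulr_ge0// divr_ge0// ltW.
have xp : 0 < x by rewrite lt_neqAle eq_sym xn.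
have yp := xy xp.
have u0 : 0 < (s * y) / (t * x) by rewrite divr_gt0// mulr_gt0.
have := @le_ln1Dx R ((s * y) / (t * x) - 1).
rewrite ltrBDl subrr => /(_ u0); rewrite addrCA subrr addr0.
rewrite ln_div ?posrE ?mulr_gt0// !lnM ?posrE// => h.
have := ler_wpM2l x0 h.
have -> : x * (s * y / (t * x) - 1) = s / t * y - x by field; rewrite !gt_eqF.
by rewrite /shannon_term => {}h; nra.
Qed.

Lemma gibbs s t x y : sums_to x s -> sums_to y t ->
  (forall i, 0 < x i -> 0 < y i) ->
  (shannon s x <= \esum_(i in [set: nat]) (x i * (ln t - ln (y i)))%:E)%E.
Proof.
move=> xs yt xy.
have rhs0 i : 0 <= x i * (ln t - ln (y i)).
  have := xs.1 i; rewrite le_eqVlt => /predU1P[<-|xp]; first by rewrite mul0r.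
  by rewrite mulr_ge0 ?(ltW xp)// subr_ge0 ler_ln_pos ?xy// (sums_to_le i yt).
have [s0|sn] := eqVneq s 0.
  rewrite s0 in xs; rewrite [X in (X <= _)%E](_ : _ = 0)%E.
    by apply: esum_ge0 => i _; rewrite lee_fin.
  by apply: esum1 => i _; rewrite esum0_eq0// shannon_term0.
have sp : 0 < s by rewrite lt_neqAle eq_sym sn (sums_to_ge0 xs).
have tp : 0 < t.
  rewrite lt_neqAle (sums_to_ge0 yt) andbT eq_sym; apply/eqP => t0.
  rewrite t0 in yt; have y0 := esum0_eq0 yt.
  have x0 i : x i = 0.
    apply/eqP; rewrite eq_le xs.1 andbT leNgt; apply/negP => /xy.
    by rewrite y0 ltxx.
  move: xs => [_]; rewrite esum1; last by move=> i _; rewrite x0.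
  by move=> [/esym s0]; rewrite s0 eqxx in sn.
(* The real s is added to both sides, as the sum of x_i on the left and of (s / t) y_i on the right.
   All terms of [gibbs_term] are then nonnegative and can be summed even if the entropies are
   infinite. *)
rewrite -(@leeD2rE _ s%:E)//.
have {1}<- := xs.2.
have e : s%:E = \esum_(i in [set: nat]) (s / t * y i)%:E.
  under eq_esum do rewrite EFinM.
  rewrite esum_mulr ?yt.2 ?divr_ge0 ?ltW//; last by move=> i _; rewrite lee_fin yt.1.
  by rewrite -EFinM divfK// gt_eqF.
rewrite [in leRHS]e /shannon -!esumD; first last.
- by move=> i _; rewrite lee_fin xs.1.
- by move=> i _; rewrite lee_fin shannon_term_ge0 ?xs.1// (sums_to_le i xs).
- by move=> i _; rewrite lee_fin mulr_ge0 ?yt.1// divr_ge0// ltW.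
- by move=> i _; rewrite lee_fin.
apply: le_esum => i _; rewrite -!EFinD lee_fin.
by apply: gibbs_term => //; [exact: xs.1|exact: yt.1|exact: xy].
Qed.

(** Both x and y are compared with x + y by [gibbs]; the two cross entropies add up, term by term,
    to the entropy of x + y. *)
Lemma shannon_superadd s t x y : sums_to x s -> sums_to y t ->
  (shannon s x + shannon t y <= shannon (s + t)%R (fun i => (x i + y i)%R))%E.
Proof.
move=> xs yt; have wst := sums_toD xs yt.
have h1 := gibbs xs wst _; have h2 := gibbs yt wst _.
have {}h1 := h1 (fun i xp => ltr_wpDr (yt.1 i) xp).
have {}h2 := h2 (fun i xp => ltr_wpDl (xs.1 i) xp).
apply: (le_trans (leeD h1 h2)).
have g (z : nat -> R) i : 0 <= z i <= x i + y i ->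
    (0 <= (z i * (ln (s + t) - ln (x i + y i)))%:E)%E.
  move=> /andP[]; rewrite lee_fin le_eqVlt => /predU1P[<-|zp zw]; first by rewrite mul0r.
  rewrite mulr_ge0 ?(ltW zp)// subr_ge0 ler_ln_pos ?(lt_le_trans zp)//.
  exact: (sums_to_le i wst).
rewrite -esumD.
- by apply: le_esum => i _; rewrite -EFinD lee_fin /shannon_term -mulrDl.
- by move=> i _; apply: (g x); rewrite xs.1 lerDl yt.1.
- by move=> i _; apply: (g y); rewrite yt.1 lerDr xs.1.
Qed.

Lemma shannon_superaddB s t x w : (forall i, x i <= w i) -> sums_to x s ->
  sums_to w t -> (shannon s x + shannon (t - s)%R (fun i => (w i - x i)%R) <= shannon t w)%E.
Proof.
move=> xw xs wt; have := shannon_superadd xs (sums_toB xw xs wt).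
have -> : (fun i => x i + (w i - x i)) = w by apply/funext => i; ring.
by rewrite (addrC s) subrK.
Qed.

Lemma shannon_mono s t x w : (forall i, x i <= w i) -> sums_to x s ->
  sums_to w t -> (shannon s x <= shannon t w)%E.
Proof.
move=> xw xs wt; apply: le_trans (shannon_superaddB xw xs wt).
by rewrite leeDl// shannon_ge0//; exact: sums_toB.
Qed.

(** The origin of g: it is the extended entropy of the two-point sequence (1, d). *)
Lemma gfunE (d : R) : gfun d = shannon_term (1 + d) 1 + shannon_term (1 + d) d.
Proof. by rewrite /gfun /shannon_term ln1 (addrC d 1); ring. Qed.

Lemma gfun_ge0 (d : R) : 0 <= d -> 0 <= gfun d.
Proof. by move=> d0; rewrite gfunE addr_ge0// shannon_term_ge0// ?lerDl ?lerDr. Qed.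

(** Monotonicity of the extended entropy, for the pairs (1, d) and (1, e): Gibbs against (1, e) in
    [h1] and [h2], where the linear terms cancel by [h3], and then d is raised to e in [h4]. *)
Lemma gfun_mono (d e : R) : 0 <= d -> d <= e -> gfun d <= gfun e.
Proof.
move=> d0 de; have e0 := le_trans d0 de.
have h1 := @gibbs_term (1 + d) (1 + e) 1 1 (ltr_wpDr d0 ltr01) (ltr_wpDr e0 ltr01) ler01 ler01 id.
have h2 := @gibbs_term (1 + d) (1 + e) d e (ltr_wpDr d0 ltr01) (ltr_wpDr e0 ltr01) d0 e0
  (fun dp => lt_le_trans dp de).
have h3 : (1 + d) / (1 + e) * 1 + (1 + d) / (1 + e) * e = 1 + d.
  by field; rewrite gt_eqF// ltr_wpDr.
have h4 : d * (ln (1 + e) - ln e) <= e * (ln (1 + e) - ln e).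
  have [ez|en] := eqVneq e 0; first by have -> : d = e by lra.
  have ep : 0 < e by rewrite lt_neqAle eq_sym en.
  by rewrite ler_wpM2r// subr_ge0 ler_ln_pos// lerDr.
rewrite !gfunE; move: h1 h2 h3 h4; rewrite /shannon_term ln1; lra.
Qed.

(** Splitting each entry q_i + a_i in two raises the entropy, since ln is increasing. The split
    sequence is still measured against the mass 1 + d; passing to the separate masses 1 and d leaves
    ln (1 + d) + d (ln (1 + d) - ln d), which is g(d). The equation [e] spreads this amount over the
    indices, so that the comparison is termwise. *)
Lemma shannon_subadd q a d : sums_to q 1 -> sums_to a d ->
  (shannon (1 + d)%R (fun i => (q i + a i)%R) <= shannon 1 q + shannon d a + (gfun d)%:E)%E.
Proof.
move=> qs ad; have d0 := sums_to_ge0 ad.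
have T1 : 1 <= 1 + d by rewrite lerDl.
have lT0 : 0 <= ln (1 + d) by exact: ln_ge0.
have aT i : 0 <= a i * (ln (1 + d) - ln d).
  have := ad.1 i; rewrite le_eqVlt => /predU1P[<-|ap]; first by rewrite mul0r.
  rewrite mulr_ge0 ?(ltW ap)// subr_ge0 ler_ln_pos ?lerDr//.
  exact: lt_le_trans (sums_to_le i ad).
have e : (gfun d)%:E = (\esum_(i in [set: nat]) (ln (1 + d) * q i)%:E
   + \esum_(i in [set: nat]) (a i * (ln (1 + d) - ln d))%:E)%E.
  under eq_esum do rewrite EFinM.
  rewrite esum_mulr ?qs.2//; last by move=> i _; rewrite lee_fin qs.1.
  have [d0'|dn] := eqVneq d 0.
    have a0 : sums_to a 0 by rewrite -d0'.
    rewrite esum1; last by move=> i _; rewrite (esum0_eq0 a0) mul0r.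
    by rewrite -EFinM -EFinD gfunE d0' shannon_term0 /shannon_term !addr0 ln1; congr EFin; ring.
  have dp : 0 < d by rewrite lt_neqAle eq_sym dn.
  under [X in (_ + X)%E]eq_esum do rewrite mulrC EFinM.
  rewrite esum_mulr ?ad.2//; first last.
  - by move=> i _; rewrite lee_fin ad.1.
  - by rewrite subr_ge0 ler_ln_pos// lerDr.
  by rewrite -!EFinM -EFinD gfunE /shannon_term ln1; congr EFin; ring.
move: (qs.1) (ad.1) => q0 a0.
have hq i : 0 <= shannon_term 1 (q i) by rewrite shannon_term_ge0 ?(sums_to_le i qs).
have ha i : 0 <= shannon_term d (a i) by rewrite shannon_term_ge0 ?(sums_to_le i ad).
have hl i : 0 <= ln (1 + d) * q i by rewrite mulr_ge0.
rewrite {}e /shannon -!esumD; try by move=> i _; rewrite -?EFinD lee_fin ?addr_ge0.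
apply: le_esum => i _; rewrite -!EFinD lee_fin /shannon_term mulrDl ln1.
have h (z : R) : 0 <= z -> z <= q i + a i ->
    z * (ln (1 + d) - ln (q i + a i)) <= z * (ln (1 + d) - ln z).
  rewrite le_eqVlt => /predU1P[<-|zp zw]; first by rewrite !mul0r.
  by rewrite ler_wpM2l// ?(ltW zp)// lerD2l lerN2 ler_ln_pos.
have h1 := h (q i) (q0 i); have h2 := h (a i) (a0 i).
have {}h1 := h1 ltac:(by rewrite lerDl).
have {}h2 := h2 ltac:(by rewrite lerDr).
apply: le_trans (lerD h1 h2) _; rewrite le_eqVlt; apply/orP; left; apply/eqP; ring.
Qed.

End ClassicalEntropy.

(** * Truncated sequences: bounds and limits *)

Section EntropyBounds.
Context {R : realType}.
Implicit Types p q r : nat -> R.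

Definition above (eps : R) p : nat -> R := (fun x => Num.max (x - eps) 0) \o p.
Definition below (eps : R) p : nat -> R := (fun x => Num.min x eps) \o p.

(** The witness is a = (p - q)_+. It lies below r - q, whose sum is T - 1 <= eps; each single a_i is
    at most this sum. *)
Lemma excess_le p q r (T eps : R) : sums_to q 1 -> sums_to r T ->
  T <= 1 + eps -> (forall i, p i <= r i) -> (forall i, q i <= r i) ->
  exists a d, [/\ sums_to a d, d <= eps, forall i, a i <= eps,
    forall i, a i <= Num.max (p i) 0 & forall i, p i <= q i + a i].
Proof.
move=> qs rT Te pr qr; have rq := sums_toB qr qs rT.
have [i|d ad /andP[d0 dT]] := @sums_to_dominated _ (fun i => Num.max (p i - q i) 0) _ _ _ rq.
  by rewrite le_max lexx orbT/= ge_max subr_ge0 qr lerD2r pr.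
have de : d <= eps by lra.
exists (fun i => Num.max (p i - q i) 0), d; split=> // i.
- exact: le_trans (sums_to_le i ad) de.
- rewrite ge_max le_max le_max lexx orbT andbT.
  by rewrite lerBlDr lerDl qs.1.
- by rewrite -lerBlDl le_max lexx.
Qed.

Lemma shannon_truncated_le p q r (T s eps : R) : sums_to q 1 -> sums_to r T ->
  T <= 1 + eps -> (forall i, p i <= r i) -> (forall i, q i <= r i) ->
  sums_to (above eps p) s ->
  (shannon s (above eps p) <= shannon 1 q)%E.
Proof.
move=> qs rT Te pr qr xs.
have [a [d [_ _ ae _ pa]]] := excess_le qs rT Te pr qr.
apply: (shannon_mono _ xs qs) => i; rewrite /above/= ge_max qs.1 andbT lerBlDr.
by apply: le_trans (pa i) _; rewrite lerD2l.
Qed.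

Lemma shannon_min_le p q r (T t eps : R) : sums_to p 1 -> sums_to q 1 ->
  sums_to r T -> T <= 1 + eps -> (forall i, p i <= r i) ->
  (forall i, q i <= r i) -> sums_to (below eps p) t ->
  (shannon 1 p <= shannon 1 q + shannon t (below eps p) + (gfun eps)%:E)%E.
Proof.
move=> ps qs rT Te pr qr mt.
have [a [d [ad de ae ap pa]]] := excess_le qs rT Te pr qr.
apply: le_trans (shannon_mono pa ps (sums_toD qs ad)) _.
apply: le_trans (shannon_subadd qs ad) _.
rewrite -addeA -[leRHS]addeA leeD2l// leeD//.
  apply: (shannon_mono _ ad mt) => i; rewrite /below/= le_min ae andbT.
  by have := ap i; rewrite max_l// ps.1.
by rewrite lee_fin gfun_mono// (sums_to_ge0 ad).
Qed.

Lemma shannon_truncation_superadd p (s t eps : R) : sums_to p 1 ->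
  sums_to (above eps p) s ->
  sums_to (below eps p) t ->
  (shannon s (above eps p) + shannon t (below eps p)
     <= shannon 1 p)%E.
Proof.
move=> ps xs mt; have := shannon_superadd xs mt.
have e : (fun i => above eps p i + below eps p i) = p.
  apply/funext => i; rewrite /above /below/=; rewrite /Num.max /Num.min; do 2 case: ifPn => /=; lra.
by rewrite e; have := sums_toD xs mt; rewrite e => /(sums_to_uniq ps) <-.
Qed.

Lemma gfun_cvg0 : gfun eps @[eps --> (0 : R)^'+] --> (0 : R).
Proof.
(* The bound comes from ln (e + 1) <= e and from - ln e = 2 ln (1 / sqrt e) <= 2 / sqrt e. *)
have h : (fun e : R => e + e ^+ 2 + 2 * Num.sqrt e) @ (0 : R)^'+ --> (0 : R).
  rewrite [X in _ --> X](_ : _ = 0 + 0 ^+ 2 + 2 * Num.sqrt 0); last first.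
    by rewrite expr0n/= sqrtr0 mulr0 !addr0.
  apply: cvg_at_right_filter; apply: cvgD.
    by apply: cvgD; [exact: cvg_id|exact: exprn_continuous].
  by apply: cvgMr; exact: sqrt_continuous.
apply: squeeze_cvgr (cvg_cst 0) h.
near=> e; have e0 : 0 < e by [].
rewrite (gfun_ge0 (ltW e0)) /= /gfun.
have l1 : ln (e + 1) <= e.
  by rewrite addrC; apply: le_ln1Dx; apply: lt_trans e0; rewrite ltrN10.
have s0 : 0 < Num.sqrt e by rewrite sqrtr_gt0.
have ee : e = Num.sqrt e ^+ 2 by rewrite sqr_sqrtr// ltW.
have l2 : - ln e <= 2 / Num.sqrt e.
  rewrite {1}ee lnXn// -[X in - X]mulr_natl -mulrN -lnV ?posrE// ler_pM2l//.
  by apply: ltW; apply: ln_sublinear; rewrite invr_gt0.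
have l3 : - (e * ln e) <= 2 * Num.sqrt e.
  rewrite -mulrN; apply: le_trans (ler_wpM2l (ltW e0) l2) _.
  by rewrite {1}ee le_eqVlt; apply/orP; left; apply/eqP; field; rewrite gt_eqF.
have l4 : (e + 1) * ln (e + 1) <= (e + 1) * e by rewrite ler_wpM2l// addr_ge0// ltW.
rewrite expr2; lra.
Unshelve. all: by end_near. Qed.

(** For a function that stays below L, lower semicontinuity alone is convergence to L, be it finite
    or not. *)
Lemma cvge_lower_bound (T : Type) (F : set_system T) {FF : Filter F}
    (f : T -> \bar R) (L : \bar R) :
  (\forall t \near F, (f t <= L)%E) ->
  (forall M : R, (M%:E < L)%E -> \forall t \near F, (M%:E < f t)%E) ->
  f @ F --> L.
Proof.
case: L => [r| |] fL Lf.
- apply/fine_cvgP; split.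
    have := Lf (r - 1); rewrite lte_fin ltrBlDr ltrDl => /(_ ltr01).
    apply: filterS2 fL => t; case: (f t) => //.
  apply/cvgrPdist_lt => e e0.
  have := Lf (r - e); rewrite lte_fin ltrBlDr ltrDl => /(_ e0).
  apply: filterS2 fL => t /=; case: (f t) => [u| |]//=.
  by rewrite lee_fin lte_fin => ur h; rewrite ger0_norm ?subr_ge0// ltrBlDl -ltrBlDr.
- by apply/cvgeyPgt => A; apply: Lf; rewrite ltry.
- apply: cvg_near_cst; apply: filterS fL => t.
  by rewrite leeNy_eq => /eqP.
Qed.

Lemma above_cvg p i : above eps p i @[eps --> (0 : R)^'+] --> Num.max (p i) 0.
Proof.
apply/cvgrPdist_lt => d d0; near=> e.
have e0 : 0 < e by [].
have ed : e < d by near: e; exact: nbhs_right_lt.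
rewrite /above/= ltr_norml /Num.max; do 2 case: ifPn => ?; apply/andP; split; lra.
Unshelve. all: by end_near. Qed.

Lemma cvgr_sum (T I : Type) (F : set_system T) {FF : Filter F} (r : seq I)
    (f : I -> T -> R) (l : I -> R) :
  (forall i, f i @ F --> l i) ->
  (\sum_(i <- r) f i t) @[t --> F] --> \sum_(i <- r) l i.
Proof. by move=> h; apply: cvg_big => // ; exact: add_continuous. Qed.

Lemma sum_above_cvg p m : (forall i, 0 <= p i) ->
  (\sum_(i < m) above eps p i) @[eps --> (0 : R)^'+] --> \sum_(i < m) p i.
Proof.
move=> p0; apply: cvgr_sum => i.
by have := @above_cvg p i; rewrite max_l.
Qed.

(** Only finite sums are taken to the limit. The first n terms carry more than M of the entropy of
    p, and the mass [s eps], an infinite sum, is bounded below by its m-term part [um eps]; this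
    lowers the logarithms only a little if m is large. *)
Lemma shannon_above_cvg p (s : R -> R) : sums_to p 1 ->
  (forall eps, 0 < eps -> sums_to (above eps p) (s eps)) ->
  (shannon (s eps) (above eps p) - (gfun eps)%:E)%E @[eps --> (0 : R)^'+]
    --> shannon 1 p.
Proof.
move=> ps xs; have p0 := ps.1; apply: cvge_lower_bound.
  near=> e; have e0 : 0 < e by [].
  rewrite leeBlDr//; apply: (@le_trans _ _ (shannon 1 p)).
    apply: (shannon_mono _ (xs e e0) ps) => i; rewrite /above/= ge_max p0 andbT.
    by rewrite lerBlDr lerDl ltW.
  by rewrite leeDl// lee_fin gfun_ge0// ltW.
move=> M /esum_nat_lt[i|n]; first by rewrite shannon_term_ge0// (sums_to_le i ps).
rewrite lte_fin; set K := \sum_(i < n) _ => MK.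
(* With u > c in place of the mass 1, the n terms lose at most (K - M) / 2 in total, since the sum
   of their p_i is at most 1. The limit of [G] thus stays above M. *)
pose c := expR (- ((K - M) / 2)).
have : (c%:E < \esum_(i in [set: nat]) (p i)%:E)%E.
  by rewrite ps.2 lte_fin /c -[ltRHS]expR0 ltr_expR; lra.
move=> /esum_nat_lt[//|m]; rewrite lte_fin; set u := \sum_(i < m) p i => cu.
have c0 : 0 < c by exact: expR_gt0.
have u0 : 0 < u by exact: lt_trans cu.
have u1 : u <= 1 by exact: sums_to_ord_le ps.
have lnu : - ((K - M) / 2) < ln u by rewrite -[ltLHS]expRK ltr_ln.
pose um e := \sum_(i < m) above e p i.
have um_cvg : um @ (0 : R)^'+ --> u by exact: sum_above_cvg.
pose G e := \sum_(i < n) above e p i * (ln (um e) - ln (above e p i)) - gfun e.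
have G_cvg : G @ (0 : R)^'+ --> \sum_(i < n) p i * (ln u - ln (p i)) - 0.
  apply: cvgB; last exact: gfun_cvg0.
  (* The logarithm is not continuous at 0, but where p_i = 0 the truncated entry is 0 for all e >
     0. *)
  apply: cvgr_sum => i; have [pi0|pin] := eqVneq (p i) 0.
    rewrite pi0 mul0r; apply: cvg_near_cst; near=> e.
    have e0 : 0 < e by [].
    by rewrite /above/= pi0 max_r ?mul0r//; lra.
  have pip : 0 < p i by rewrite lt_neqAle eq_sym pin p0.
  have a_cvg : above e p i @[e --> (0 : R)^'+] --> p i.
    by have := @above_cvg p i; rewrite max_l.
  apply: cvgM => //; apply: cvgB.
    by apply: cvg_comp um_cvg _; exact: continuous_ln.
  by apply: cvg_comp a_cvg _; exact: continuous_ln.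
have GM : M < \sum_(i < n) p i * (ln u - ln (p i)) - 0.
  have -> : \sum_(i < n) p i * (ln u - ln (p i)) - 0 = K + ln u * \sum_(i < n) p i.
    rewrite subr0 mulr_sumr -big_split/=; apply: eq_bigr => i _.
    by rewrite /shannon_term ln1; ring.
  have pn1 : \sum_(i < n) p i <= 1 by exact: sums_to_ord_le ps.
  have pn0 : 0 <= \sum_(i < n) p i by exact: sumr_ge0.
  have : ln u <= 0 by exact: ln_le0.
  move: lnu; nra.
near=> e.
have e0 : 0 < e by [].
have Me : M < G e by near: e; exact: (cvgr_gt _ G_cvg).
have ue : 0 < um e by near: e; exact: (cvgr_gt _ um_cvg).
have xe := xs e e0.
apply: (@lt_le_trans _ _ (G e)%:E); first by rewrite lte_fin.
rewrite EFinB leeB//.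
apply: le_trans; last first.
  apply: (esum_ge_ord n) => i; rewrite shannon_term_ge0 ?(sums_to_le i xe)//; exact: xe.1.
rewrite lee_fin; apply: ler_sum => i _.
rewrite /shannon_term ler_wpM2l ?(xe.1)// lerD2r ler_ln_pos//.
exact: sums_to_ord_le xe.
Unshelve. all: by end_near. Qed.

Lemma shannon_below_cvg p (s t : R -> R) : sums_to p 1 -> (shannon 1 p < +oo)%E ->
  (forall eps, 0 < eps -> sums_to (above eps p) (s eps)) ->
  (forall eps, 0 < eps -> sums_to (below eps p) (t eps)) ->
  (shannon 1 p - shannon (t eps) (below eps p) - (gfun eps)%:E)%E @[eps --> (0 : R)^'+]
    --> shannon 1 p.
Proof.
move=> ps pfin xs mt.
apply: squeeze_cvge (shannon_above_cvg ps xs) (cvg_cst (shannon 1 p)).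
near=> e; have e0 : 0 < e by [].
have h := shannon_truncation_superadd ps (xs e e0) (mt e e0).
have b0 := shannon_ge0 (mt e e0).
have bfin : shannon (t e) (below e p) \is a fin_num.
  rewrite ge0_fin_numE//; apply: le_lt_trans pfin; apply: le_trans h.
  by rewrite leeDr// shannon_ge0//; exact: xs.
have pfin' : shannon 1 p \is a fin_num by rewrite ge0_fin_numE// shannon_ge0.
apply/andP; split; first by rewrite leeB// leeBrDr.
rewrite leeBlDr// leeBlDr//.
rewrite -addeA leeDl// adde_ge0// lee_fin gfun_ge0// ltW.
Unshelve. all: by end_near. Qed.

End EntropyBounds.

(** * Hilbert space geometry *)

Section ComplexParts.
Context {R : realType}.
Implicit Types a b : R[i].

Lemma complex_eqP a b : Re a = Re b -> Im a = Im b -> a = b.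
Proof. by case: a b => [? ?] [? ?] /= -> ->. Qed.

Lemma Re_add a b : Re (a + b) = Re a + Re b. Proof. by case: a b => [? ?] []. Qed.
Lemma Im_add a b : Im (a + b) = Im a + Im b. Proof. by case: a b => [? ?] []. Qed.
Lemma Re_opp a : Re (- a) = - Re a. Proof. by case: a. Qed.
Lemma Im_opp a : Im (- a) = - Im a. Proof. by case: a. Qed.
Lemma Re_mul a b : Re (a * b) = Re a * Re b - Im a * Im b.
Proof. by case: a b => [? ?] []. Qed.
Lemma Im_mul a b : Im (a * b) = Re a * Im b + Im a * Re b.
Proof. by case: a b => [? ?] []. Qed.
Lemma Re_conjc a : Re (conjc a) = Re a. Proof. by case: a. Qed.
Lemma Im_conjc a : Im (conjc a) = - Im a. Proof. by case: a. Qed.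

Definition ReImE := (Re_add, Im_add, Re_opp, Im_opp, Re_mul, Im_mul, Re_conjc, Im_conjc).

Lemma Re_sum (I : Type) (s : seq I) (F : I -> R[i]) :
  Re (\sum_(i <- s) F i) = \sum_(i <- s) Re (F i).
Proof. by elim: s => [|i s IH]; rewrite ?big_nil// !big_cons Re_add IH. Qed.

(** The squared modulus with values in R; the norm of [R[i]] has values in [R[i]]. *)
Definition sqn a : R := Re a ^+ 2 + Im a ^+ 2.

Lemma sqn_ge0 a : 0 <= sqn a. Proof. by rewrite addr_ge0 ?sqr_ge0. Qed.

Lemma sqn_eq0 a : sqn a = 0 -> a = 0.
Proof.
move=> /eqP; rewrite paddr_eq0 ?sqr_ge0// !sqrf_eq0 => /andP[/eqP ? /eqP ?].
exact: complex_eqP.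
Qed.

Lemma sqnM a b : sqn (a * b) = sqn a * sqn b.
Proof. by rewrite /sqn !ReImE; ring. Qed.

Lemma sqnC (r : R) : sqn r%:C = r ^+ 2.
Proof. by rewrite /sqn /= expr0n/= addr0. Qed.

Lemma sqnJ a : sqn (conjc a) = sqn a.
Proof. by rewrite /sqn !ReImE sqrrN. Qed.

Lemma mulJE a : a * conjc a = (sqn a)%:C.
Proof. by apply: complex_eqP; rewrite /sqn !ReImE /=; ring. Qed.

End ComplexParts.

Section Hilbert.
Context {R : realType} {H : completeNormedModType R[i]}.
Variable dot : {dot H for (@Num.conj R[i])}.

Lemma dotDl x y z : dot (x + y) z = dot x z + dot y z.
Proof. exact: (linearDl dot). Qed.
Lemma dotDr x y z : dot x (y + z) = dot x y + dot x z.
Proof. exact: (linearDr dot). Qed.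
Lemma dotNl x z : dot (- x) z = - dot x z.
Proof. exact: (linearNl dot). Qed.
Lemma dotNr x z : dot z (- x) = - dot z x.
Proof. exact: (linearNr dot). Qed.
Lemma dotBl x y z : dot (x - y) z = dot x z - dot y z.
Proof. exact: (linearBl dot). Qed.
Lemma dotBr x y z : dot x (y - z) = dot x y - dot x z.
Proof. exact: (linearBr dot). Qed.
Lemma dot0l z : dot 0 z = 0. Proof. exact: (linear0l dot). Qed.
Lemma dot0r z : dot z 0 = 0. Proof. exact: (linear0r dot). Qed.
Lemma dotZl a x z : dot (a *: x) z = a * dot x z.
Proof. exact: (linearZl_LR dot). Qed.
Lemma dotZr a x z : dot z (a *: x) = conjc a * dot z x.
Proof. exact: (linearZr_LR dot). Qed.
Lemma dotC x y : dot y x = conjc (dot x y).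
Proof. by rewrite (hermC dot) expr0 mul1r. Qed.
Lemma dot_suml (I : Type) (s : seq I) (F : I -> H) z :
  dot (\sum_(i <- s) F i) z = \sum_(i <- s) dot (F i) z.
Proof. by elim: s => [|i s IH]; rewrite ?big_nil ?dot0l// !big_cons dotDl IH. Qed.
Lemma dot_sumr (I : Type) (s : seq I) (F : I -> H) z :
  dot z (\sum_(i <- s) F i) = \sum_(i <- s) dot z (F i).
Proof. by elim: s => [|i s IH]; rewrite ?big_nil ?dot0r// !big_cons dotDr IH. Qed.

Definition dotE := (dotDl, dotDr, dotBl, dotBr, dotNl, dotNr, dotZl, dotZr, dot0l, dot0r).

Lemma Re_dotC x y : Re (dot y x) = Re (dot x y). Proof. by rewrite dotC Re_conjc. Qed.

Lemma sqn_dotC x y : sqn (dot y x) = sqn (dot x y).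
Proof. by rewrite dotC sqnJ. Qed.

(** The squared norm as a real number. Estimates are made with it throughout, which avoids square
    roots and the order of [R[i]]. *)
Definition nq (x : H) : R := Re (dot x x).

Lemma dotxx x : dot x x = (nq x)%:C.
Proof.
apply: complex_eqP => //=; apply: ger0_Im.
exact: (dnorm_ge0 (C := R[i]) dot).
Qed.

Lemma nq_ge0 x : 0 <= nq x.
Proof. by rewrite -(@lecR R) -dotxx (dnorm_ge0 (C := R[i]) dot). Qed.

Lemma nq0 : nq 0 = 0. Proof. by rewrite /nq dot0l. Qed.

Lemma nq_eq0 x : nq x = 0 -> x = 0.
Proof.
by move=> x0; apply/eqP; rewrite -(dnorm_eq0 (C := R[i]) dot) dotxx x0.
Qed.

Lemma nqD x y : nq (x + y) = nq x + 2 * Re (dot x y) + nq y.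
Proof. by rewrite /nq !dotE !ReImE (Re_dotC x y); ring. Qed.

Lemma nqN x : nq (- x) = nq x.
Proof. by rewrite /nq !dotE opprK. Qed.

Lemma nqB x y : nq (x - y) = nq x - 2 * Re (dot x y) + nq y.
Proof. by rewrite nqD nqN dotNr Re_opp; ring. Qed.

Lemma nqBC x y : nq (x - y) = nq (y - x).
Proof. by rewrite -nqN opprB. Qed.

Lemma nqZ a x : nq (a *: x) = sqn a * nq x.
Proof. by rewrite {1}/nq dotZl dotZr mulrA mulJE dotxx Re_mul /= mul0r subr0. Qed.

Lemma nqD_le x y : nq (x + y) <= 2 * nq x + 2 * nq y.
Proof. have := nq_ge0 (x - y); rewrite nqB nqD; lra. Qed.

Lemma nqB_le x y : nq (x - y) <= 2 * nq x + 2 * nq y.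
Proof. by rewrite -(nqN y) nqD_le. Qed.

Lemma dot_eq0 x : (forall y, dot x y = 0) -> x = 0.
Proof. by move=> h; apply: nq_eq0; rewrite /nq h. Qed.

Section PositiveOperators.
Variable A : H -> H.
Hypothesis linA : linear A.
Hypothesis posA : positive_op dot A.

Lemma opD x y : A (x + y) = A x + A y.
Proof. by have := linA 1 x y; rewrite !scale1r. Qed.
Lemma op0 : A 0 = 0.
Proof. by have := opD 0 0; rewrite addr0 => /eqP; rewrite -subr_eq subrr => /eqP. Qed.
Lemma opZ a x : A (a *: x) = a *: A x.
Proof. by have := linA a x 0; rewrite addr0 op0 addr0. Qed.
Lemma opN x : A (- x) = - A x.
Proof. by rewrite -scaleN1r opZ scaleN1r. Qed.
Lemma opB x y : A (x - y) = A x - A y.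
Proof. by rewrite opD opN. Qed.
Lemma positive_Im x : Im (dot (A x) x) = 0. Proof. exact/ger0_Im/posA. Qed.
Lemma positive_Re x : 0 <= Re (dot (A x) x).
Proof. by have := posA x; rewrite lecE => /andP[]. Qed.

(* Polarisation: x + y and x + i y have a real quadratic form. *)
Lemma positive_self_adjoint x y : dot (A x) y = dot x (A y).
Proof.
rewrite (dotC (A y)); apply: complex_eqP; rewrite !ReImE.
- have := positive_Im (x + 'i%C *: y).
  rewrite opD opZ !dotE !ReImE /= !positive_Im; lra.
- have := positive_Im (x + y).
  rewrite opD !dotE !ReImE /= !positive_Im; lra.
Qed.

Lemma positive_CS x y :
  sqn (dot (A x) y) <= Re (dot (A x) x) * Re (dot (A y) y).
Proof.
pose b := dot (A x) y.
(* The quadratic form at s x - t b y; the factor b = <A x, y> makes the cross term real. *)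
have key s t : 0 <= s ^+ 2 * Re (dot (A x) x) - 2 * s * t * sqn b
    + t ^+ 2 * sqn b * Re (dot (A y) y).
  have := positive_Re (s%:C *: x - (t%:C * b) *: y).
  rewrite opB !opZ !dotE -/b.
  rewrite (positive_self_adjoint y x) (dotC (A x) y) -/b.
  have := positive_Im x; have := positive_Im y.
  move: (dot (A x) x) (dot (A y) y) b => [a ai] [c ci] [b bi] /= -> ->.
  rewrite /sqn /=; set l := (X in 0 <= X) => h; set r := (X in 0 <= X).
  suff -> : r = l by [].
  by rewrite /l /r; ring.
have a0 := positive_Re x; have c0 := positive_Re y; have b0 := sqn_ge0 b.
rewrite -/b; move: (Re (dot (A x) x)) (Re (dot (A y) y)) (sqn b) a0 c0 b0 key => a c B a0 c0 B0 key.
have [c_gt0|] := ltrP 0 c.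
  have := key c 1; rewrite !expr1n !mulr1 !mul1r => h.
  have : 0 <= c * (a * c - B) by lra.
  by rewrite pmulr_rge0// subr_ge0.
move=> c_le0; have cz : c = 0 by lra.
rewrite {}cz in key *.
rewrite mulr0 leNgt; apply/negP => Bp.
(* As c = 0, the form is affine in t, and this t gives it the value a - 2 (a + 1) < 0. *)
have := key 1 ((a + 1) / B).
rewrite mulr0 addr0 expr1n mul1r mulr1.
rewrite -!mulrA mulVf ?gt_eqF// mulr1; lra.
Qed.

(** Cauchy-Schwarz for the form of A at x and A x gives |A x|^4 <= <A x, x> <A A x, A x>, and the
    last factor is at most K |A x|^2. This is how a small quadratic form forces a small A x in the
    sequel. *)
Lemma positive_sqr_le K x : (forall y, Re (dot (A y) y) <= K * nq y) ->
  nq (A x) <= K * Re (dot (A x) x).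
Proof.
move=> hK; have := positive_CS x (A x); rewrite -/(nq (A x)).
have h := hK (A x); have q0 := positive_Re x; have n0 := nq_ge0 (A x).
rewrite dotxx sqnC => cs.
have [z|/eqP nz] := eqVneq (nq (A x)) 0.
  have := hK x; have := nq_ge0 x; rewrite z => nx hx.
  have [/eqP|nx0] := eqVneq (nq x) 0; last first.
    have nxp : 0 < nq x by rewrite lt_neqAle eq_sym nx0.
    apply: mulr_ge0 => //.
    by rewrite -(pmulr_lge0 _ nxp) (le_trans q0).
  by move=> /eqP/nq_eq0 ->; rewrite dot0r mulr0.
have np : 0 < nq (A x) by rewrite lt_neqAle n0 andbT eq_sym; apply/eqP.
rewrite -(ler_pM2l np); rewrite expr2 in cs; apply: (le_trans cs).
by rewrite mulrA mulrC ler_wpM2r// mulrC.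
Qed.

End PositiveOperators.

Lemma id_linear : linear (@id H). Proof. by []. Qed.
Lemma id_positive : positive_op dot id.
Proof. by move=> x; rewrite dotxx ler0c nq_ge0. Qed.

Lemma dot_CS x y : sqn (dot x y) <= nq x * nq y.
Proof. exact: (positive_CS id_linear id_positive x y). Qed.

Lemma Re_dot_CS x y : Re (dot x y) ^+ 2 <= nq x * nq y.
Proof. by apply: le_trans (dot_CS x y); rewrite lerDl sqr_ge0. Qed.

Hypothesis hH : hilbert dot.

Lemma normE x : `|x| = (Num.sqrt (nq x))%:C.
Proof.
apply/eqP; rewrite -(@eqrXn2 _ 2)//; last by rewrite lecR sqrtr_ge0.
by rewrite hH dotxx -rmorphXn /= sqr_sqrtr ?nq_ge0.
Qed.

Lemma norm_lt x (e : R) : 0 < e -> (`|x| < e%:C) = (nq x < e ^+ 2).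
Proof.
move=> e0; rewrite normE ltcR -{2}(sqr_sqrtr (nq_ge0 x)).
by rewrite ltr_pXn2r ?nnegrE ?sqrtr_ge0// ltW.
Qed.

Lemma cvg_nqP (T : Type) (F : set_system T) {FF : Filter F} (f : T -> H) (y : H) :
  (f @ F --> y) <-> ((fun t => nq (f t - y)) @ F --> (0 : R)).
Proof.
split.
  move=> /cvgrPdist_lt h; apply/cvgrPdist_lt => e e0.
  have se0 : 0 < Num.sqrt e by rewrite sqrtr_gt0.
  have := h (Num.sqrt e)%:C; rewrite ltcR => /(_ se0).
  apply: filterS => t; rewrite norm_lt// sqr_sqrtr ?ltW// sub0r normrN nqBC.
  by rewrite ger0_norm ?nq_ge0.
move=> /cvgrPdist_lt h; apply/cvgrPdist_lt => e e0.
have -> : e = (Re e)%:C.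
  by apply: complex_eqP => //=; apply: ger0_Im; exact: ltW.
have e0' : 0 < Re e by move: e0; rewrite ltcE => /andP[].
have := h (Re e ^+ 2); rewrite exprn_gt0// => /(_ isT).
by apply: filterS => t; rewrite norm_lt// sub0r normrN nqBC ger0_norm ?nq_ge0.
Qed.

Lemma nq_cauchy_ex (F : set_system H) {FF : ProperFilter F} :
  (forall e : R, 0 < e -> exists y, F [set x | nq (x - y) < e]) -> cvg F.
Proof.
move=> h; apply: cauchy_cvg; apply/cauchyP => e e0.
have -> : e = (Re e)%:C.
  by apply: complex_eqP => //=; apply: ger0_Im; exact: ltW.
have e0' : 0 < Re e by move: e0; rewrite ltcE => /andP[].
have [|y Fy] := h (Re e ^+ 2); first by rewrite exprn_gt0.
exists y; apply: filterS Fy => x /=.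
by rewrite -ball_normE /= norm_lt// nqBC.
Qed.

End Hilbert.

(** * Orthonormal families: Bessel, limits of inner products, Parseval *)

Section Orthonormal.
Context {R : realType} {H : completeNormedModType R[i]}.
Variable dot : {dot H for (@Num.conj R[i])}.
Local Notation nq := (nq dot).

Section Family.
(** Orthonormality is required on P only, because in a spectral representation the vectors at
    padding indices are arbitrary. *)
Context {I : choiceType} {P : I -> Prop} {e : I -> H}.
Hypothesis one : forall i j, P i -> P j -> dot (e i) (e j) = (i == j)%:R.

Lemma on_nq i : P i -> nq (e i) = 1.
Proof. by move=> Pi; rewrite /nq one// eqxx. Qed.

Lemma on_coord (s : seq I) (c : I -> R[i]) k : uniq s ->
  (forall i, i \in s -> P i) -> P k ->
  dot (\sum_(i <- s) c i *: e i) (e k) = if k \in s then c k else 0.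
Proof.
move=> us sP Pk; rewrite dot_suml.
have h i : i \in s -> dot (c i *: e i) (e k) = if i == k then c k else 0.
  move=> /sP Pi; rewrite dotZl one//; case: eqP => [->|]; last by rewrite mulr0.
  by rewrite mulr1.
rewrite (eq_big_seq _ h) -big_mkcond; case: ifPn => ks.
  by rewrite (big_rem k ks)/= eqxx big_seq_cond big1 ?addr0// => i;
     rewrite rem_filter// mem_filter/= => /andP[/andP[/negP]].
by rewrite big_seq_cond big1// => i /andP[si /eqP ik]; rewrite -ik si in ks.
Qed.

Lemma on_nq_sum (s : seq I) (c : I -> R[i]) : uniq s ->
  (forall i, i \in s -> P i) ->
  nq (\sum_(i <- s) c i *: e i) = \sum_(i <- s) sqn (c i).
Proof.
move=> us sP; rewrite /nq dot_sumr Re_sum; apply: eq_big_seq => k ks.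
rewrite dotZr on_coord// ?ks; last exact: sP.
by rewrite mulrC mulJE.
Qed.

(** The square is completed in each coefficient. Bessel is the case c i = <x, e_i>; in
    [top_eigenvector] the coefficients are limits of coordinates instead. *)
Lemma on_nq_sub (s : seq I) (c : I -> R[i]) x : uniq s ->
  (forall i, i \in s -> P i) ->
  nq (x - \sum_(i <- s) c i *: e i) =
  nq x - \sum_(i <- s) sqn (dot x (e i))
    + \sum_(i <- s) sqn (c i - dot x (e i)).
Proof.
move=> us sP; rewrite nqB on_nq_sum// dot_sumr Re_sum -!addrA; congr +%R.
rewrite mulr_sumr -!sumrN -!big_split/=; apply: eq_bigr => i _.
by rewrite dotZr /sqn !ReImE; ring.
Qed.

Lemma bessel (s : seq I) x : uniq s -> (forall i, i \in s -> P i) ->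
  \sum_(i <- s) sqn (dot x (e i)) <= nq x.
Proof.
move=> us sP; have := nq_ge0 dot (x - \sum_(i <- s) dot x (e i) *: e i).
rewrite on_nq_sub// [X in _ + X]big1 ?addr0 ?subr_ge0// => i _.
by rewrite subrr /sqn expr0n/= addr0.
Qed.

Lemma bessel_esum (x : H) : (\esum_(i in P) (sqn (dot x (e i)))%:E <= (nq x)%:E)%E.
Proof.
by apply: esum_le_seq => s us sP; rewrite sumEFin lee_fin bessel.
Qed.

End Family.

Section Limits.
Hypothesis hH : hilbert dot.
Context {T : Type} {F : set_system T} {FF : ProperFilter F}.

Lemma hcvg_unique (f : T -> H) (y z : H) : f @ F --> y -> f @ F --> z -> y = z.
Proof. by move=> fy fz; apply: (cvg_unique _ fy fz). Qed.

Lemma cvg_Re_dot (f : T -> H) (y z : H) : f @ F --> y ->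
  (fun t => Re (dot (f t) z)) @ F --> Re (dot y z).
Proof.
move=> /(cvg_nqP hH)/cvgrPdist_lt fy; apply/cvgrPdist_lt => d d0.
have K0 : 0 < nq z + 1 by rewrite ltr_wpDl// nq_ge0.
have d2 : 0 < d ^+ 2 / (nq z + 1) by rewrite divr_gt0// exprn_gt0.
apply: filterS (fy _ d2) => t; rewrite sub0r normrN ger0_norm ?nq_ge0// => h.
rewrite -Re_opp -Re_add -dotBl -(@ltr_pXn2r _ 2)// ?nnegrE ?ltW//.
rewrite real_normK ?num_real//; apply: le_lt_trans (Re_dot_CS _ _ _) _.
rewrite nqBC; have := nq_ge0 dot z; have := nq_ge0 dot (f t - y).
rewrite ltr_pdivlMr// in h; nra.
Qed.

Lemma cvg_dot_eq (f : T -> H) (y z : H) (c : R[i]) : f @ F --> y ->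
  (\forall t \near F, dot (f t) z = c) -> dot y z = c.
Proof.
move=> fy fc.
have re (a : H) (b : R[i]) : (\forall t \near F, dot (f t) a = b) -> Re (dot y a) = Re b.
  move=> fa; have h1 := @cvg_Re_dot f y a fy.
  have h2 : (fun t => Re (dot (f t) a)) @ F --> Re b.
    by apply: cvg_near_cst; apply: filterS fa => t ->.
  exact: (cvg_unique _ h1 h2).
apply: complex_eqP; first exact: re.
have := re ('i%C *: z) (conjc 'i%C * c); rewrite dotZr !ReImE/=.
by rewrite !mul0r !sub0r !mulN1r !opprK; apply; apply: filterS fc => t; rewrite dotZr => ->.
Qed.

Lemma cvg_nq (f : T -> H) (y : H) : f @ F --> y ->
  (fun t => nq (f t)) @ F --> nq y.
Proof.
move=> fy; have h1 := @cvg_Re_dot f y y fy; have h2 := (cvg_nqP hH f y).1 fy.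
rewrite -[X in _ --> X](_ : 2 * Re (dot y y) - nq y + 0 = nq y); last first.
  by rewrite -/(nq y) addr0; ring.
rewrite (_ : (fun t => nq (f t)) =
  (fun t => 2 * Re (dot (f t) y) - nq y + nq (f t - y))); last first.
  by apply/funext => t; rewrite nqB; ring.
have h3 : (fun t => 2 * Re (dot (f t) y)) @ F --> 2 * Re (dot y y).
  by apply: cvgM h1; exact: cvg_cst.
have h4 : (fun t => 2 * Re (dot (f t) y) - nq y) @ F --> 2 * Re (dot y y) - nq y.
  by apply: (cvgB h3); exact: cvg_cst.
exact: (cvgD h4 (h2 _)).
Qed.

End Limits.

Section Parseval.
Hypothesis hH : hilbert dot.
Variable E : set H.
Hypothesis bE : orthonormal_basis dot E.

Let oE i j : E i -> E j -> dot i j = (i == j)%:R. Proof. exact: bE.1. Qed.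

(** As E may be uncountable, the sum S is approached by finite sets [s n]. Enlarging [s n] moves the
    projection of x by at most [v n] in squared norm, so the projections are Cauchy. Their limit y
    has the coordinates of x, hence y = x by maximality of E, and the squared norms of the
    projections never exceed S. *)
Lemma parseval x : \esum_(u in E) (sqn (dot x u))%:E = (nq x)%:E.
Proof.
have le := bessel_esum (e := id) oE x.
have ge : (0 <= \esum_(u in E) (sqn (dot x u))%:E)%E.
  by apply: esum_ge0 => i _; rewrite lee_fin sqn_ge0.
have fin : \esum_(u in E) (sqn (dot x u))%:E \is a fin_num.
  by rewrite ge0_fin_numE// (le_lt_trans le)// ltry.
pose S := fine (\esum_(u in E) (sqn (dot x u))%:E).
have ES : \esum_(u in E) (sqn (dot x u))%:E = S%:E by rewrite /S fineK.
have sumS (s : seq H) : uniq s -> (forall i, i \in s -> E i) ->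
    \sum_(u <- s) sqn (dot x u) <= S.
  by move=> us sE; rewrite -lee_fin -ES -sumEFin; exact: esum_ge_seq.
pose proj (s : seq H) := \sum_(u <- s) dot x u *: u.
have [v v0 small] : exists2 v : nat -> R, (forall n, 0 < v n) &
    forall d, 0 < d -> exists N, forall n, (N <= n)%N -> v n < d.
  exists (fun n => n.+1%:R^-1) => [n|d d0]; first by rewrite invr_gt0.
  exists (Num.trunc d^-1) => n Nn.
  rewrite invf_plt ?posrE// (lt_le_trans (truncnS_gt _))//.
  by rewrite ler_nat ltnS.
have approx n : exists s : seq H, [/\ uniq s, forall i, i \in s -> E i &
    S - v n < \sum_(u <- s) sqn (dot x u)].
  have [|s [us sE]] := @esum_approx R _ E (fun u => (sqn (dot x u))%:E) (S - v n)%:E.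
    by rewrite ES lte_fin ltrBlDr ltrDl.
  by rewrite sumEFin lte_fin => h; exists s.
have [s hs] := choice approx.
have nq_proj (a b : seq H) : uniq a -> uniq b -> (forall i, i \in a -> E i) ->
    (forall i, i \in b -> E i) -> {subset a <= b} ->
    nq (proj b - proj a) <= S - \sum_(u <- a) sqn (dot x u).
  move=> ua ub aE bE' ab.
  have -> : proj b - proj a = \sum_(u <- [seq u <- b | u \notin a]) dot x u *: u.
    rewrite /proj (bigID (mem a))/= big_filter addrAC.
    rewrite -[X in X - _ + _]big_filter (perm_big a) ?subrr ?add0r//.
    apply: uniq_perm => //; first by rewrite filter_uniq.
    by move=> u; rewrite mem_filter; apply/andP/idP => [[]//|ua']; split=> //; exact: ab.
  rewrite (on_nq_sum oE) ?filter_uniq//; last first.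
    by move=> i; rewrite mem_filter => /andP[_]; exact: bE'.
  rewrite lerBrDr; apply: le_trans (sumS b ub bE').
  rewrite [leRHS](bigID (mem a) predT)/= big_filter [leLHS]addrC lerD2r.
  rewrite -[leRHS]big_filter [leRHS](perm_big a)//.
  apply: uniq_perm => //; first by rewrite filter_uniq.
  by move=> u; rewrite mem_filter; apply/andP/idP => [[]//|ua']; split=> //; exact: ab.
have union n (t : seq H) : uniq t -> (forall i, i \in t -> E i) ->
    nq (proj (undup (s n ++ t)) - proj (s n)) <= v n.
  move=> ut tE; have [us sE h] := hs n.
  apply: le_trans (nq_proj _ _ us (undup_uniq _) sE _ _) _.
  - by move=> i; rewrite mem_undup mem_cat => /orP[/sE|/tE].
  - by move=> i is_; rewrite mem_undup mem_cat is_.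
  - by rewrite lerBlDr -lerBlDl ltW.
have cauchy_y : cvg ((fun n => proj (s n)) @ \oo).
  apply: (nq_cauchy_ex hH) => d d0.
  have [N hN] := small (d / 4) ltac:(lra).
  exists (proj (s N)); exists N => // n /= Nn.
  have [uN sN _] := hs N; have [un sn _] := hs n.
  have := union n (s N) uN sN; have := union N (s n) un sn.
  have e : proj (undup (s N ++ s n)) = proj (undup (s n ++ s N)).
    apply: perm_big; apply: uniq_perm; rewrite ?undup_uniq// => u.
    by rewrite !mem_undup !mem_cat orbC.
  rewrite e; set z := proj (undup _) => h1 h2.
  have -> : proj (s n) - proj (s N) = (proj (s n) - z) + (z - proj (s N)).
    by rewrite addrA subrK.
  apply: le_lt_trans (nqD_le dot _ _) _; rewrite (nqBC _ (proj (s n))).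
  have := hN N (leqnn N); have := hN n Nn; lra.
have [y yE] : exists y : H, (fun n => proj (s n)) @ \oo --> y.
  by exists (lim ((fun n => proj (s n)) @ \oo)).
have yx : x = y.
  apply/eqP; rewrite -subr_eq0; apply/eqP/bE.2 => u Eu.
  (* Adjoining u to every [s n] does not change the limit, but fixes its coordinate along u to that
     of x. *)
  pose z n := proj (undup (s n ++ [:: u])).
  have zy : z @ \oo --> y.
    apply/(cvg_nqP hH)/cvgrPdist_lt => d d0.
    have [N hN] := small (d / 4) ltac:(lra).
    move/(cvg_nqP hH)/cvgrPdist_lt: yE => /(_ (d / 4) ltac:(lra)) yE.
    near=> n; rewrite sub0r normrN ger0_norm ?nq_ge0//.
    have -> : z n - y = (z n - proj (s n)) + (proj (s n) - y) by rewrite addrA subrK.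
    apply: le_lt_trans (nqD_le dot _ _) _.
    have h1 : nq (z n - proj (s n)) <= v n.
      by apply: union => // i; rewrite inE => /eqP->.
    have h2 : `|0 - nq (proj (s n) - y)| < d / 4 by near: n.
    rewrite sub0r normrN ger0_norm ?nq_ge0// in h2.
    have h3 : v n < d / 4 by apply: hN; near: n; exact: nbhs_infty_ge.
    lra.
  apply/eqP; rewrite dotBl subr_eq0 eq_sym; apply/eqP.
  apply: (cvg_dot_eq hH zy); near=> n.
  rewrite (on_coord oE) ?undup_uniq//; last first.
    move=> i; rewrite mem_undup mem_cat inE => /orP[|/eqP->//].
    by have [_ sE _] := hs n; exact: sE.
  by rewrite mem_undup mem_cat mem_head orbT.
apply/eqP; rewrite eq_le le /= {1}yx ES lee_fin.
rewrite leNgt; apply/negP => lt; have h := cvg_nq hH yE.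
have [N _ /(_ N (leqnn N))/=] := cvgr_gt _ (h _) _ lt.
by have [us sE _] := hs N; rewrite (on_nq_sum oE)// ltNge sumS.
Unshelve. all: by end_near. Qed.

End Parseval.

End Orthonormal.

(** * Spectral representations *)

Lemma esum_cvg {R : realType} (a : nat -> R) (S : R) : (forall i, 0 <= a i) ->
  (fun n => \sum_(i < n) a i) @ \oo --> S ->
  \esum_(i in [set: nat]) (a i)%:E = S%:E.
Proof.
move=> a0 aS; rewrite -nneseries_esumT; last by move=> i; rewrite lee_fin.
apply/cvg_lim => //; under eq_fun do rewrite sumEFin big_mkord.
by apply/fine_cvgP; split => //; apply: nearW.
Qed.

Section SpectralRepr.
Context {R : realType} {H : completeNormedModType R[i]}.
Variable dot : {dot H for (@Num.conj R[i])}.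
Hypothesis hH : hilbert dot.
Local Notation nq := (nq dot).
Implicit Types (K : R) (l : nat -> R) (e : nat -> H).

Definition psum l e n (x : H) : H :=
  \sum_(i < n) ((l i)%:C * dot x (e i)) *: e i.

Definition on_support l e : Prop :=
  forall i j, l i != 0 -> l j != 0 -> dot (e i) (e j) = (i == j)%:R.

Lemma psumB l e N n x : (N <= n)%N -> psum l e n x - psum l e N x =
  \sum_(i <- [seq i <- index_iota N n | l i != 0]) ((l i)%:C * dot x (e i)) *: e i.
Proof.
move=> Nn; rewrite /psum -!(big_mkord xpredT (fun i => ((l i)%:C * dot x (e i)) *: e i)).
rewrite (big_cat_nat (leq0n N) Nn)//= addrAC subrr add0r big_filter [RHS]big_mkcond.
by apply: eq_bigr => i _; case: eqP => //= ->; rewrite mul0r scale0r.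
Qed.

Lemma nq_psumB l e N n x : on_support l e -> (N <= n)%N ->
  nq (psum l e n x - psum l e N x) =
  \sum_(N <= i < n) l i ^+ 2 * sqn (dot x (e i)).
Proof.
move=> le Nn; rewrite psumB// (on_nq_sum (P := fun i => l i != 0) le).
- rewrite big_filter big_mkcond; apply: eq_bigr => i _.
  by rewrite sqnM sqnC; case: eqP => //= ->; rewrite expr0n/= mul0r.
- by rewrite filter_uniq// iota_uniq.
- by move=> i; rewrite mem_filter => /andP[].
Qed.

Lemma psum0 l e x : psum l e 0 x = 0. Proof. by rewrite /psum big_ord0. Qed.

Lemma nq_psum l e n x : on_support l e ->
  nq (psum l e n x) = \sum_(i < n) l i ^+ 2 * sqn (dot x (e i)).
Proof.
move=> le; have := nq_psumB x le (leq0n n).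
by rewrite psum0 subr0 big_mkord.
Qed.

Lemma psum_coord l e n k x : on_support l e -> l k != 0 -> (k < n)%N ->
  dot (psum l e n x) (e k) = (l k)%:C * dot x (e k).
Proof.
move=> le lk kn; have := psumB l e x (leq0n n); rewrite psum0 subr0 => ->.
rewrite (on_coord (P := fun i => l i != 0) le)//.
- by rewrite mem_filter lk mem_index_iota kn.
- by rewrite filter_uniq// iota_uniq.
- by move=> i; rewrite mem_filter => /andP[].
Qed.

Lemma Re_dot_psum l e n x :
  Re (dot (psum l e n x) x) = \sum_(i < n) l i * sqn (dot x (e i)).
Proof.
rewrite /psum dot_suml Re_sum; apply: eq_bigr => i _.
by rewrite dotZl (dotC _ x) -mulrA mulJE -rmorphM.
Qed.

Lemma sqr_le_bound (a K : R) : `|a| <= K -> a ^+ 2 <= K ^+ 2.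
Proof.
move=> aK; rewrite -real_normK ?num_real// ler_pXn2r// nnegrE.
exact: le_trans aK.
Qed.

Lemma nq_psum_le l e n x K : on_support l e -> (forall i, `|l i| <= K) ->
  nq (psum l e n x) <= K ^+ 2 * nq x.
Proof.
move=> le lK; rewrite nq_psum//.
have b : \sum_(i <- [seq i <- index_iota 0 n | l i != 0]) sqn (dot x (e i)) <= nq x.
  apply: (bessel (P := fun i => l i != 0) le).
    by rewrite filter_uniq// iota_uniq.
  by move=> i; rewrite mem_filter => /andP[].
apply: le_trans (ler_wpM2l (sqr_ge0 K) b); rewrite big_filter mulr_sumr.
rewrite big_mkord [leRHS]big_mkcond; apply: ler_sum => i _.
case: ifPn => [_|/negPn/eqP->]; last by rewrite expr0n/= mul0r.
by rewrite ler_wpM2r ?sqn_ge0// sqr_le_bound.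
Qed.

Lemma spectral_repr_exists l e K : on_support l e -> (forall i, `|l i| <= K) ->
  exists B, spectral_repr dot B l e.
Proof.
move=> le lK.
suff cv x : cvg ((fun n => psum l e n x) @ \oo).
  by exists (fun x => lim ((fun n => psum l e n x) @ \oo)); split=> // x; exact: cv.
apply: (nq_cauchy_ex hH) => d d0.
pose a i := l i ^+ 2 * sqn (dot x (e i)).
have a0 i : 0 <= a i by rewrite mulr_ge0 ?sqr_ge0 ?sqn_ge0.
have ub : (\esum_(i in [set: nat]) (a i)%:E <= (K ^+ 2 * nq x)%:E)%E.
  by apply: esum_le_ord => // n; rewrite lee_fin -nq_psum// nq_psum_le.
have [|N] := @esum_nat_lt R a (\esum_(i in [set: nat]) (a i)%:E - d%:E)%E a0.
  rewrite lteBlDr// lteDl ?lte_fin// ge0_fin_numE ?(le_lt_trans ub) ?ltry//.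
  by apply: esum_ge0 => i _; rewrite lee_fin.
rewrite lteBlDr// => hN.
exists (psum l e N x); exists N => // n /= Nn; rewrite nq_psumB//.
have := le_lt_trans (esum_ge_ord n a0) hN.
rewrite -EFinD lte_fin -!(big_mkord xpredT a) (big_cat_nat (leq0n N) Nn)//= => h.
by rewrite -(ltrD2l (\sum_(0 <= i < N) a i)); exact: le_lt_trans h.
Qed.

Section Repr.
Variables (A : H -> H) (l : nat -> R) (e : nat -> H).
Hypothesis Ale : spectral_repr dot A l e.
Let on : on_support l e. Proof. exact: Ale.1. Qed.
Let cvA x : (fun n => psum l e n x) @ \oo --> A x. Proof. exact: Ale.2. Qed.

Lemma repr_coord x k : l k != 0 -> dot (A x) (e k) = (l k)%:C * dot x (e k).
Proof.
move=> lk; apply: (cvg_dot_eq hH (@cvA x)).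
by exists k.+1 => // n /= kn; rewrite psum_coord.
Qed.

Lemma repr_linear : linear A.
Proof.
move=> a x y; apply: (hcvg_unique (F := \oo) (@cvA (a *: x + y))).
have -> : (fun n => psum l e n (a *: x + y)) =
    (fun n => a *: psum l e n x + psum l e n y).
  apply/funext => n; rewrite /psum scaler_sumr -big_split/=.
  apply: eq_bigr => i _; rewrite scalerA -scalerDl; congr (_ *: _).
  by rewrite !dotE; ring.
by apply: cvgD; [apply: cvgZr|]; exact: cvA.
Qed.

Lemma repr_eigen k : l k != 0 -> A (e k) = (l k)%:C *: e k.
Proof.
move=> lk; apply: (hcvg_unique (F := \oo) (@cvA (e k))).
apply: cvg_near_cst; exists k.+1 => // n /= kn.
rewrite /psum (bigD1 (Ordinal kn))//= on// eqxx mulr1 big1 ?addr0// => i ik.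
have [->|li] := eqVneq (l i) 0; first by rewrite mul0r scale0r.
rewrite on//; case: eqP => [ki|]; last by rewrite mulr0 scale0r.
by move: ik; rewrite -val_eqE/= -ki eqxx.
Qed.

Lemma repr_nq_le K x : (forall i, `|l i| <= K) -> nq (A x) <= K ^+ 2 * nq x.
Proof.
move=> lK; rewrite leNgt; apply/negP => lt.
have h := cvg_nq hH (@cvA x).
have [N _ /(_ N (leqnn N))/=] := cvgr_gt _ (h _) _ lt.
by rewrite ltNge nq_psum_le.
Qed.

Lemma repr_bounded K : (forall i, `|l i| <= K) -> bounded_op A.
Proof.
move=> lK; split; first exact: repr_linear.
move=> x; apply/(cvg_nqP hH)/cvgrPdist_lt => d d0.
have K0 : 0 < K ^+ 2 + 1 by rewrite ltr_wpDl// sqr_ge0.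
have idx : (fun y => nq (y - x)) @ x --> (0 : R).
  by apply/(cvg_nqP hH (@id H)); exact: cvg_id.
move/cvgrPdist_lt : idx => /(_ (d / (K ^+ 2 + 1))).
rewrite divr_gt0// => /(_ isT); apply: filterS => y.
rewrite !sub0r !normrN !ger0_norm ?nq_ge0// ltr_pdivlMr// => h.
rewrite -(opB repr_linear); apply: le_lt_trans (repr_nq_le _ lK) _.
have := nq_ge0 dot (y - x); nra.
Qed.

Lemma repr_eigen_ge0 : positive_op dot A -> forall i, 0 <= l i.
Proof.
move=> posA i; have [->//|li] := eqVneq (l i) 0.
have := posA (e i); rewrite repr_coord//.
by rewrite on// eqxx mulr1 ler0c.
Qed.

Hypothesis l0 : forall i, 0 <= l i.

Lemma repr_quad x :
  \esum_(i in [set: nat]) (l i * sqn (dot x (e i)))%:E = (Re (dot (A x) x))%:E.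
Proof.
apply: esum_cvg => [i|]; first by rewrite mulr_ge0 ?sqn_ge0.
under eq_fun do rewrite -Re_dot_psum.
exact: (@cvg_Re_dot _ _ _ hH _ \oo _ _ _ x (@cvA x)).
Qed.

Lemma repr_positive : positive_op dot A.
Proof.
move=> x; rewrite lecE; apply/andP; split; last first.
  by rewrite -lee_fin -repr_quad esum_ge0// => i _; rewrite lee_fin mulr_ge0 ?sqn_ge0.
(* This real part is the imaginary part of <A x, x>; it vanishes for each partial sum. *)
have re : Re (dot (A x) ('i%C *: x)) = 0.
  have h1 := @cvg_Re_dot _ _ _ hH _ \oo _ _ _ ('i%C *: x) (@cvA x).
  have h2 : (fun n => Re (dot (psum l e n x) ('i%C *: x))) @ \oo --> (0 : R).
    apply: cvg_near_cst; apply: nearW => n.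
    rewrite /psum dot_suml Re_sum big1// => i _.
    rewrite dotZl dotZr (dotC _ x) mulrCA -[_%:C * _ * _]mulrA mulJE.
    by rewrite !ReImE /=; ring.
  exact: (cvg_unique _ (h1 _) h2).
by move: re; rewrite dotZr !ReImE/= => h; apply/eqP; lra.
Qed.

(** After the sums are exchanged, Parseval gives each e_i with l_i nonzero the total weight 1. The
    result does not involve E, so it shows that the trace is independent of the basis. *)
Lemma repr_trace (E : set H) : orthonormal_basis dot E ->
  \esum_(u in E) (Re (dot (A u) u))%:E = \esum_(i in [set: nat]) (l i)%:E.
Proof.
move=> bE.
transitivity (\esum_(u in E) \esum_(i in [set: nat]) (l i * sqn (dot u (e i)))%:E).
  by apply: eq_esum => u _; rewrite repr_quad.
rewrite esum_exchange; last by move=> i j _ _; rewrite lee_fin mulr_ge0 ?sqn_ge0.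
apply: eq_esum => i _; under eq_esum do rewrite EFinM.
rewrite esum_mulr//; last by move=> j _; rewrite lee_fin sqn_ge0.
have [->|li] := eqVneq (l i) 0; first by rewrite mul0e.
under eq_esum do rewrite sqn_dotC.
by rewrite (parseval hH bE) (on_nq (P := fun i => l i != 0) on)// mule1.
Qed.

End Repr.

(* The numbers |<e_i,e'_j>|^2 form a doubly stochastic matrix which couples
   equal eigenvalues only. *)
Lemma spectral_repr_esum (A : H -> H) l e l' e' (f : R -> R) :
  spectral_repr dot A l e -> spectral_repr dot A l' e' ->
  (forall i, 0 <= l i) -> (forall i, 0 <= l' i) -> f 0 = 0 ->
  (forall i, 0 <= f (l i)) -> (forall i, 0 <= f (l' i)) ->
  \esum_(i in [set: nat]) (f (l i))%:E = \esum_(i in [set: nat]) (f (l' i))%:E.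
Proof.
(* Padding indices get the entry 0, their vectors being arbitrary; the rows and columns lost in this
   way are harmless because f 0 = 0. *)
pose m (l1 : nat -> R) (e1 : nat -> H) (l2 : nat -> R) (e2 : nat -> H) i j : R :=
  if (l1 i != 0) && (l2 j != 0) then sqn (dot (e1 i) (e2 j)) else 0.
have m0 l1 e1 l2 e2 i j : 0 <= m l1 e1 l2 e2 i j.
  by rewrite /m; case: ifP => // _; exact: sqn_ge0.
have meq l1 e1 l2 e2 i j : spectral_repr dot A l1 e1 -> spectral_repr dot A l2 e2 ->
    l1 i != l2 j -> m l1 e1 l2 e2 i j = 0.
  move=> r1 r2 lij; rewrite /m; case: ifP => // /andP[li lj].
  have := repr_coord r2 (e1 i) lj; rewrite (repr_eigen r1 li) dotZl.
  move=> /eqP; rewrite -subr_eq0 -mulrBl mulf_eq0 -rmorphB/= => /orP[|/eqP->].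
    by rewrite (_ : 0 = 0%:C)// => /eqP[/eqP]; rewrite subr_eq0 (negPf lij).
  by rewrite /sqn expr0n/= addr0.
(* The row sum is read off from <A e_i, e_i> = l_i, expanded in the second representation: only
   eigenvalues equal to l_i occur there, and l_i > 0 can be divided out. *)
have row l1 e1 l2 e2 i : spectral_repr dot A l1 e1 -> spectral_repr dot A l2 e2 ->
    (forall i, 0 <= l2 i) -> l1 i != 0 ->
    (\esum_(j in [set: nat]) (m l1 e1 l2 e2 i j)%:E = 1)%E.
  move=> r1 r2 l20 li; have := repr_quad r2 l20 (e1 i).
  rewrite (repr_coord r1 _ li) (r1.1 i i li li) eqxx mulr1 /=.
  have -> : \esum_(j in [set: nat]) (l2 j * sqn (dot (e1 i) (e2 j)))%:E =
      \esum_(j in [set: nat]) ((l1 i)%:E * (m l1 e1 l2 e2 i j)%:E)%E.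
    apply: eq_esum => j _; rewrite -EFinM; congr (_%:E).
    have [e12|ne] := eqVneq (l1 i) (l2 j); first by rewrite /m -e12 li.
    have [lj|lj] := eqVneq (l2 j) 0; first by rewrite lj mul0r meq// mulr0.
    have := meq l1 e1 l2 e2 i j r1 r2 ne; rewrite /m li lj/= => ->.
    by rewrite !mulr0.
  have mi0 j : [set: nat] j -> (0 <= (m l1 e1 l2 e2 i j)%:E)%E by rewrite lee_fin m0.
  move=> h; have l1i : 0 < l1 i.
    have := repr_eigen_ge0 r1 (repr_positive r2 l20) i.
    by rewrite le_eqVlt eq_sym (negPf li).
  rewrite esum_mulr ?ltW// in h.
  have : ((l1 i)^-1%:E * ((l1 i)%:E * \esum_(j in [set: nat]) (m l1 e1 l2 e2 i j)%:E) =
    (l1 i)^-1%:E * (l1 i)%:E)%E by rewrite h.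
  by rewrite muleA -EFinM mulVf// mul1e.
move=> r r' l0 l'0 f0 fl fl'.
have sum_row l1 e1 l2 e2 i : spectral_repr dot A l1 e1 -> spectral_repr dot A l2 e2 ->
    (forall i, 0 <= l2 i) -> 0 <= f (l1 i) ->
    (f (l1 i))%:E = \esum_(j in [set: nat]) (f (l1 i) * m l1 e1 l2 e2 i j)%:E.
  move=> r1 r2 l20 fli; under eq_esum do rewrite EFinM.
  rewrite esum_mulr//; last by move=> j _; rewrite lee_fin m0.
  have [->|li] := eqVneq (l1 i) 0; first by rewrite f0 mul0e.
  by rewrite row// mule1.
transitivity (\esum_(i in [set: nat]) \esum_(j in [set: nat]) (f (l i) * m l e l' e' i j)%:E).
  by apply: eq_esum => i _; exact: sum_row.
rewrite esum_exchange; last by move=> i j _ _; rewrite lee_fin mulr_ge0.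
apply: eq_esum => j _; rewrite (sum_row l' e' l e)//; apply: eq_esum => i _.
have [<-|ne] := eqVneq (l i) (l' j).
  by rewrite /m andbC sqn_dotC.
by rewrite meq// meq// 1?eq_sym// !mulr0.
Qed.

End SpectralRepr.

(** * The spectral theorem for positive operators of finite trace *)

Section SpectralTheorem.
Context {R : realType} {H : completeNormedModType R[i]}.
Variable dot : {dot H for (@Num.conj R[i])}.
Hypothesis hH : hilbert dot.
Local Notation nq := (nq dot).
Variable E : set H.
Hypothesis bE : orthonormal_basis dot E.
Implicit Types A B : H -> H.

Definition quad A x : R := Re (dot (A x) x).
Definition tr A : \bar R := \esum_(u in E) (quad A u)%:E.

Lemma bounded_op_le A : bounded_op A ->
  exists2 K : R, 0 < K & forall x, nq (A x) <= K * nq x.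
Proof.
move=> [linA cA].
have c0 : (fun x => nq (A x)) @ (0 : H) --> (0 : R).
  rewrite (_ : (fun x => nq (A x)) = (fun x => nq (A x - A 0))); last first.
    by apply/funext => x; rewrite (op0 linA) subr0.
  exact/(cvg_nqP hH)/cA.
move/cvgrPdist_lt : c0 => /(_ 1 ltr01)/nbhs_ballP[d /= d0 hd].
have [r r0 rd] : exists2 r : R, 0 < r & r%:C = d.
  exists (Re d); first by move: d0; rewrite ltcE => /andP[].
  by apply: complex_eqP => //=; apply/esym/ger0_Im/ltW.
have small y : nq y < r ^+ 2 -> nq (A y) < 1.
  move=> yr; have := hd y; rewrite -ball_normE/= sub0r normrN -rd (norm_lt hH)//.
  by move=> /(_ yr); rewrite sub0r normrN ger0_norm ?nq_ge0.
have r20 : 0 < r ^+ 2 by rewrite exprn_gt0.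
exists (2 / r ^+ 2) => [|x]; first by rewrite divr_gt0.
have [/nq_eq0->|xn] := eqVneq (nq x) 0; first by rewrite op0// nq0 mulr0.
have xp : 0 < nq x by rewrite lt_neqAle eq_sym xn nq_ge0.
(* Scales x to the squared norm r^2 / 2, strictly inside the ball. *)
pose s : R := Num.sqrt (r ^+ 2 / (2 * nq x)).
have s2 : s ^+ 2 = r ^+ 2 / (2 * nq x).
  by rewrite sqr_sqrtr// divr_ge0 ?mulr_ge0 ?ltW.
have := small (s%:C *: x); rewrite opZ// !nqZ !sqnC s2.
have -> : r ^+ 2 / (2 * nq x) * nq x = r ^+ 2 / 2 by field.
rewrite ltr_pdivrMr// ltr_pMr// ltr1n => /(_ isT) h.
have {}h := ltW h.
rewrite -(@ler_pM2l _ (r ^+ 2 / (2 * nq x))) ?divr_gt0 ?mulr_gt0//.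
apply: (le_trans h); rewrite le_eqVlt; apply/orP; left; apply/eqP.
by field; rewrite !gt_eqF.
Qed.

Lemma bounded_opB A B : bounded_op A -> bounded_op B ->
  bounded_op (fun x => A x - B x).
Proof.
move=> [lA cA] [lB cB]; split; last by move=> x; apply: cvgB; [exact: cA|exact: cB].
by move=> a x y; rewrite lA lB scalerBr opprD addrACA.
Qed.

Lemma bounded_opD A B : bounded_op A -> bounded_op B ->
  bounded_op (fun x => A x + B x).
Proof.
move=> [lA cA] [lB cB]; split; last by move=> x; apply: cvgD; [exact: cA|exact: cB].
by move=> a x y; rewrite lA lB scalerDr addrACA.
Qed.

Lemma bounded_opZ a A : bounded_op A -> bounded_op (fun x => a *: A x).
Proof.
move=> [lA cA]; split; last by move=> x; apply: cvgZr; exact: cA.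
by move=> b x y; rewrite lA scalerDr !scalerA mulrC.
Qed.

Lemma le_bounded_op A (K : R) : linear A -> (forall x, nq (A x) <= K * nq x) ->
  bounded_op A.
Proof.
move=> lA hK; split=> // x; apply/(cvg_nqP hH)/cvgrPdist_lt => d d0.
have [k k0 hk] : exists2 k, 0 < k & forall x, nq (A x) <= k * nq x.
  exists (`|K| + 1) => [|y]; first by rewrite ltr_wpDl.
  apply: (le_trans (hK y)); rewrite ler_wpM2r ?nq_ge0//.
  by rewrite (le_trans (ler_norm _))// lerDl.
have idx : (fun y => nq (y - x)) @ x --> (0 : R).
  by apply/(cvg_nqP hH (@id H)); exact: cvg_id.
move/cvgrPdist_lt : idx => /(_ (d / k)).
rewrite divr_gt0// => /(_ isT); apply: filterS => y.
rewrite !sub0r !normrN !ger0_norm ?nq_ge0// ltr_pdivlMr// mulrC => h.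
by rewrite -(opB lA); apply: le_lt_trans (hk _) _.
Qed.

(** For positive operators this takes the place of [trace_class]: finiteness of the trace is stated
    without the absolute value. *)
Definition good A : Prop := [/\ bounded_op A, positive_op dot A & (tr A < +oo)%E].

Lemma ultra_cvg_bounded (F : set_system H) {FF : UltraFilter F} (phi : H -> R) (C : R) :
  F [set x | `|phi x| <= C] -> exists c : R, phi @ F --> c.
Proof.
move=> FC; have PF : ProperFilter F := @ultra_proper _ _ FF.
have [|c [_ clc]] := @segment_compact R (- C) C (phi @ F) _.
  have sub : [set x | `|phi x| <= C] `<=` phi @^-1` `[- C, C].
    by move=> x; rewrite /= in_itv/= ler_norml.
  exact: filterS sub FC.
exists c => V cV; have [//|FnV] := in_ultra_setVsetC (phi @^-1` V) FF.
by have [z [nVz Vz]] := clc (~` V) V FnV cV.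
Qed.

(* Along an ultrafilter of almost maximal unit vectors x, the coordinates of
   A x converge; the finite trace makes their tails uniformly small, so A x
   converges in norm, and so does x since M x - A x tends to 0. *)
Lemma top_eigenvector A : good A -> (exists x, 0 < quad A x) ->
  exists M e, [/\ 0 < M, nq e = 1, A e = M%:C *: e &
    forall x, quad A x <= M * nq x].
Proof.
move=> [bA pA trA] [x0 qx0]; have lA := bA.1.
have [K K0 hK] := bounded_op_le bA.
have qZ (r : R) x : quad A (r%:C *: x) = r ^+ 2 * quad A x.
  rewrite /quad opZ// dotZl dotZr mulrA mulJE sqnC.
  by rewrite Re_mul/= mul0r subr0.
pose Q := [set quad A x | x in [set x | nq x = 1]].
have nrm x : nq x != 0 -> nq ((Num.sqrt (nq x))^-1%:C *: x) = 1.
  by move=> xn; rewrite nqZ sqnC exprVn sqr_sqrtr ?nq_ge0// mulVf.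
have nx0 : nq x0 != 0.
  by apply/eqP => /nq_eq0 e; move: qx0; rewrite e /quad dot0r ltxx.
have Q0 : Q !=set0 by eexists; exists ((Num.sqrt (nq x0))^-1%:C *: x0) => //; exact: nrm.
have ubQ : ubound Q (K + 1).
  move=> _ [x /= x1 <-]; have := Re_dot_CS dot (A x) x; have := hK x.
  by rewrite -/(quad A x) x1 !mulr1 => h1 h2; nra.
pose M := sup Q.
have qM1 x : nq x = 1 -> quad A x <= M.
  by move=> x1; apply: ub_le_sup; [exists (K + 1)|exists x].
have qM x : quad A x <= M * nq x.
  have [/nq_eq0->|xn] := eqVneq (nq x) 0; first by rewrite /quad dot0r nq0 mulr0.
  have := qM1 _ (nrm x xn); rewrite qZ exprVn sqr_sqrtr ?nq_ge0//.
  by rewrite ler_pdivrMl 1?mulrC// lt_neqAle eq_sym xn nq_ge0.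
have M0 : 0 < M.
  have := qM x0; have := nq_ge0 dot x0; rewrite ltNge; nra.
pose near_top (d : R) := [set x | nq x = 1 /\ M - d < quad A x].
pose F0 : set_system H := filter_from [set d : R | 0 < d] near_top.
have PF0 : ProperFilter F0.
  apply: filter_from_proper; last first.
    move=> d /= d0; have [_ [x x1 <-] h] := sup_adherent d0 (conj Q0 (ex_intro _ _ ubQ)).
    by exists x.
  apply: filter_from_filter; first by exists 1 => /=.
  move=> a b /= a0 b0; exists (Num.min a b); first by rewrite lt_min a0 b0.
  move=> x [x1 h]; split; split=> //; apply: le_lt_trans h; rewrite lerD2l lerN2.
  - by rewrite ge_min lexx.
  - by rewrite ge_min lexx orbT.
have [F [UF sub]] := ultraFilterLemma PF0.
have Ftop d : 0 < d -> F (near_top d) by move=> d0; apply: sub; exists d.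
have Funit : F [set x | nq x = 1] by apply: filterS (Ftop 1 ltr01) => x [].
have coord u : exists c : R[i], (fun x => sqn (c - dot (A x) u)) @ F --> (0 : R).
  (* The square is at most t = K * nq u, and t <= (t + 1)^2 gives a bound free of square roots. *)
  have bnd (f : R[i] -> R) : (forall z, f z ^+ 2 <= sqn z) ->
      F [set x | `|f (dot (A x) u)| <= K * nq u + 1].
    move=> hf; apply: filterS Funit => x /= x1.
    have := le_trans (hf _) (dot_CS dot (A x) u); have := hK x; rewrite x1 mulr1.
    rewrite -(real_normK (num_real (f _))); have := nq_ge0 dot u.
    have := normr_ge0 (f (dot (A x) u)) => a0 u0 h1 h2.
    have {}h2 := le_trans h2 (ler_wpM2r u0 h1); nra.
  have [|a ha] := @ultra_cvg_bounded F _ (fun x => Re (dot (A x) u)) (K * nq u + 1).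
    by apply: bnd => z; rewrite lerDl sqr_ge0.
  have [|b hb] := @ultra_cvg_bounded F _ (fun x => Im (dot (A x) u)) (K * nq u + 1).
    by apply: bnd => z; rewrite lerDr sqr_ge0.
  exists (a +i* b); rewrite [X in _ --> X](_ : _ = (a - a) ^+ 2 + (b - b) ^+ 2); last first.
    by rewrite !subrr expr0n/= addr0.
  rewrite (_ : (fun x => _) = (fun x => (a - Re (dot (A x) u)) ^+ 2 +
      (b - Im (dot (A x) u)) ^+ 2)); last first.
    by apply/funext => x; rewrite /sqn !ReImE.
  have ca : (fun x => a - Re (dot (A x) u)) @ F --> a - a.
    by apply: cvgB ha; exact: cvg_cst.
  have cb : (fun x => b - Im (dot (A x) u)) @ F --> b - b.
    by apply: cvgB hb; exact: cvg_cst.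
  by apply: cvgD; rewrite !expr2; apply: cvgM.
have [c hc] := choice coord.
have trfin : exists T, tr A = T%:E.
  exists (fine (tr A)); rewrite fineK// ge0_fin_numE//.
  by apply: esum_ge0 => u _; rewrite lee_fin positive_Re.
have [T trT] := trfin.
have q0 x : 0 <= quad A x by exact: positive_Re.
have cvA : cvg (A @ F).
  apply: (nq_cauchy_ex hH) => d d0.
  (* For unit x, Cauchy-Schwarz gives |<A x, u>|^2 <= M <A u, u>. If s carries the trace up to d1,
     the coordinates of A x outside s contribute at most M d1 = d / 2; those in s are close to their
     limits c u, which takes up the other half. *)
  pose d1 := d / (2 * M).
  have d10 : 0 < d1 by rewrite divr_gt0// mulr_gt0.
  have [|s [us sE]] := @esum_approx R _ E (fun u => (quad A u)%:E) (T - d1)%:E.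
    by rewrite -/(tr A) trT lte_fin ltrBlDr ltrDl.
  rewrite sumEFin lte_fin => hs.
  exists (\sum_(u <- s) c u *: u).
  have cs : (fun x => \sum_(u <- s) sqn (c u - dot (A x) u)) @ F --> (0 : R).
    rewrite [X in _ --> X](_ : _ = \sum_(u <- s) (0 : R)); last by rewrite big1.
    exact: cvgr_sum.
  have d20 : 0 < d / 2 by rewrite divr_gt0.
  move/cvgrPdist_lt : cs => /(_ _ d20) cs.
  apply: filterS2 Funit cs => x x1 /=; rewrite sub0r normrN => hx.
  have {}hx := le_lt_trans (ler_norm _) hx.
  rewrite (on_nq_sub (e := id) (P := E) bE.1)//.
  suff : nq (A x) <= \sum_(u <- s) sqn (dot (A x) u) + d / 2 by lra.
  rewrite -lee_fin -(parseval hH bE); apply: esum_le_seq => t ut tE.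
  rewrite sumEFin lee_fin (bigID (mem s))/=; apply: lerD.
    rewrite -big_filter [leRHS](bigID (mem t))/= -[leLHS]addr0 lerD ?sumr_ge0//.
      rewrite -[leRHS]big_filter le_eqVlt; apply/orP; left; apply/eqP.
      apply: perm_big; apply: uniq_perm; rewrite ?filter_uniq// => u.
      by rewrite !mem_filter andbC.
    by move=> u _; exact: sqn_ge0.
  rewrite -big_filter; set t' := [seq _ <- _ | _].
  have ut' : uniq (s ++ t').
    rewrite cat_uniq us filter_uniq// andbT; apply/hasPn => u.
    by rewrite mem_filter => /andP[].
  have t'E u : u \in t' -> E u by rewrite mem_filter => /andP[_ /tE].
  have := @esum_ge_seq R _ E (fun u => (quad A u)%:E) (s ++ t') ut'.
  rewrite -/(tr A) trT sumEFin lee_fin big_cat/= => /(_ _) h1.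
  have {}h1 : \sum_(u <- t') quad A u <= d1.
    have : \sum_(u <- s) quad A u + \sum_(u <- t') quad A u <= T.
      by apply: h1 => u; rewrite mem_cat => /orP[/sE|/t'E].
    lra.
  have -> : d / 2 = M * d1 by rewrite /d1; field; rewrite gt_eqF.
  apply: (@le_trans _ _ (M * \sum_(u <- t') quad A u)); last by rewrite ler_pM2l.
  rewrite mulr_sumr; apply: ler_sum => u _.
  apply: le_trans (positive_CS lA pA x u) _; rewrite -!/(quad A _).
  by rewrite ler_wpM2r// qM1.
have [z Az] : exists z : H, A @ F --> z by exists (lim (A @ F)).
(* M - A is positive and bounded by M, so |M x - A x|^2 <= M (M - <A x, x>) for unit x, and this
   tends to 0 along F. *)
pose B x := M%:C *: x - A x.
have lB : linear B.
  by move=> a x y; rewrite /B lA scalerDr scalerBr !scalerA [M%:C * a]mulrC opprD addrACA.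
have qB x : dot (B x) x = (M * nq x - quad A x)%:C.
  rewrite /B !dotE dotxx; apply: complex_eqP; rewrite !ReImE/=.
    by rewrite !mul0r subr0 /quad.
  by rewrite !mulr0 mul0r add0r (positive_Im pA) subrr.
have pB : positive_op dot B by move=> x; rewrite qB ler0c subr_ge0.
have Bx : (fun x => nq (M%:C *: x - A x - 0)) @ F --> (0 : R).
  apply/cvgrPdist_lt => d d0; have d1 : 0 < d / M by rewrite divr_gt0.
  apply: filterS (Ftop _ d1) => x [x1 hx]; rewrite sub0r normrN subr0 ger0_norm ?nq_ge0//.
  apply: le_lt_trans (positive_sqr_le lB pB (K := M) _ _) _.
    by move=> y; rewrite qB/= lerBlDr lerDl.
  rewrite qB/= x1 mulr1 -ltr_pdivlMl// mulrC; lra.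
have {}Bx : (fun x => M%:C *: x - A x) @ F --> (0 : H) by apply/(cvg_nqP hH).
have MC : M%:C != 0 by apply/eqP => -[M0']; rewrite M0' ltxx in M0.
pose e := M%:C^-1 *: z.
have xe : id @ F --> e.
  have h : (fun x => M%:C^-1 *: (M%:C *: x - A x + A x)) @ F --> M%:C^-1 *: (0 + z).
    by apply: cvgZr; apply: cvgD.
  have E1 : (fun x => M%:C^-1 *: (M%:C *: x - A x + A x)) = id.
    by apply/funext => x; rewrite subrK scalerA mulVf// scale1r.
  by rewrite E1 add0r in h.
have ne : nq e = 1.
  have h := @cvg_nq _ _ _ hH _ F _ id e xe.
  have h' : (fun x : H => nq x) @ F --> (1 : R).
    by apply: cvg_near_cst; apply: filterS Funit => x /= ->.
  exact: (cvg_unique _ (h _) h').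
exists M, e; split=> //.
have Ae : A @ F --> A e by apply: cvg_comp xe _; exact: bA.2.
by rewrite (hcvg_unique Ae Az) /e scalerA mulfV// scale1r.
Qed.

End SpectralTheorem.

(** * Deflation and the spectral representation *)

Section Deflation.
Context {R : realType} {H : completeNormedModType R[i]}.
Variable dot : {dot H for (@Num.conj R[i])}.
Hypothesis hH : hilbert dot.
Local Notation nq := (nq dot).
Variable E : set H.
Hypothesis bE : orthonormal_basis dot E.
Implicit Types A B : H -> H.
Local Notation quad := (quad dot).
Local Notation tr := (tr dot E).
Local Notation good := (good dot E).

(* A maximal eigenpair; (0, e) with any e is allowed when A = 0. *)
Definition top_pair A (M : R) (e : H) : Prop :=
  [/\ 0 <= M, M != 0 -> nq e = 1, A e = M%:C *: e &
      forall x, quad A x <= M * nq x].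

Lemma top_pair_exists A : good A -> exists Me : R * H, top_pair A Me.1 Me.2.
Proof.
move=> gA; have [h|h] := pselect (exists x, 0 < quad A x).
  have [M [e [M0 e1 Ae qA]]] := top_eigenvector hH bE gA h.
  by exists (M, e); split=> //=; exact: ltW.
exists (0, 0); split=> //=; first by rewrite eqxx.
- by rewrite scaler0 op0//; case: gA => -[].
- move=> x; rewrite mul0r leNgt; apply/negP => q0; apply: h; by exists x.
Qed.

Definition deflate A (M : R) (e : H) : H -> H :=
  fun x => A x - (M%:C * dot x e) *: e.

Section Step.
Variables (A : H -> H) (M : R) (e : H).
Hypotheses (gA : good A) (Me : top_pair A M e).

Lemma quad_deflate x : quad (deflate A M e) x = quad A x - M * sqn (dot x e).
Proof.
rewrite /quad /deflate dotBl dotZl (dotC dot x e) -mulrA mulJE Re_add Re_opp.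
by rewrite Re_mul/= mul0r subr0.
Qed.

Lemma deflate_positive : positive_op dot (deflate A M e).
Proof.
have [[lA _] pA _] := gA; have [M0 e1 Ae qA] := Me.
have [Mz|Mn] := eqVneq M 0.
  by move=> x; rewrite /deflate Mz mul0r scale0r subr0.
(* As e is an eigenvector, the deflated form at x is the form of A at x minus its component along
   e. *)
move=> x; rewrite (_ : dot _ _ = dot (A (x - dot x e *: e)) (x - dot x e *: e)) //.
rewrite (opB lA) (opZ lA) Ae /deflate !dotE.
rewrite (positive_self_adjoint lA pA x e) Ae !dotE (dotxx _ e) e1// (dotC dot x e).
by rewrite conjc_real; ring.
Qed.

Lemma deflate_good : good (deflate A M e).
Proof.
have [bA pA trA] := gA; have [M0 e1 Ae qA] := Me; split.
- apply: bounded_opB => //; apply: (@le_bounded_op _ _ _ hH _ (M ^+ 2)).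
    by move=> a x y; rewrite dotDl dotZl mulrDr scalerDl mulrCA scalerA.
  move=> x; have [Mz|Mn] := eqVneq M 0.
    by rewrite Mz mul0r scale0r nq0 expr0n/= mul0r.
  rewrite nqZ sqnM sqnC e1// mulr1 ler_wpM2l ?sqr_ge0//.
  by apply: le_trans (dot_CS _ _ _) _; rewrite e1// mulr1.
- exact: deflate_positive.
- apply: le_lt_trans trA; apply: le_esum => u _; rewrite lee_fin quad_deflate.
  by rewrite lerBlDr lerDl mulr_ge0 ?sqn_ge0.
Qed.

Lemma tr_deflate : (tr A = tr (deflate A M e) + M%:E)%E.
Proof.
have [bA pA trA] := gA; have [M0 e1 Ae qA] := Me.
have hM : M%:E = \esum_(u in E) (M * sqn (dot u e))%:E.
  under eq_esum do rewrite EFinM.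
  rewrite esum_mulr//; last by move=> u _; rewrite lee_fin sqn_ge0.
  under eq_esum do rewrite sqn_dotC.
  rewrite (parseval hH bE); have [->|Mn] := eqVneq M 0; first by rewrite mul0e.
  by rewrite e1// mule1.
rewrite [X in (_ + X)%E]hM -esumD.
- by apply: eq_esum => u _; rewrite quad_deflate -EFinD subrK.
- by move=> u _; rewrite lee_fin (positive_Re deflate_positive).
- by move=> u _; rewrite lee_fin mulr_ge0 ?sqn_ge0.
Qed.

End Step.

(** Top eigenpairs are split off one after the other. Each step lowers the trace by l n, so the l n
    are summable and, being decreasing, tend to 0. The remainder [T n] has a form bounded by l n,
    and [positive_sqr_le] turns this into [T n x] tending to 0. *)
Theorem spectral_theorem A : good A -> exists l e,
  [/\ spectral_repr dot A l e, forall n, 0 <= l n & forall n, l n.+1 <= l n].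
Proof.
move=> gA.
(* A choice for all operators at once, with a default pair where none is asked for, allows the plain
   recursion [iter]. *)
have /choice[f hf] : forall B, exists Me : R * H, good B -> top_pair B Me.1 Me.2.
  move=> B; have [/top_pair_exists[Me h]|h] := pselect (good B); first by exists Me.
  by exists (0, 0) => /h.
pose T n := iter n (fun B => deflate B (f B).1 (f B).2) A.
pose l n := (f (T n)).1; pose e n := (f (T n)).2.
have TS n x : T n.+1 x = T n x - ((l n)%:C * dot x (e n)) *: e n by [].
have gT n : good (T n) by elim: n => [//|n IH]; apply: deflate_good => //; exact: hf.
have pT n : top_pair (T n) (l n) (e n) by exact: hf.
have l0 n : 0 <= l n by case: (pT n).
have qS n x : quad (T n.+1) x <= quad (T n) x.
  by rewrite [leLHS](quad_deflate (T n)) lerBlDr lerDl mulr_ge0 ?sqn_ge0//; exact: l0.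
have linT n : linear (T n) by case: (gT n) => -[].
have posT n : positive_op dot (T n) by case: (gT n).
have lS n : l n.+1 <= l n.
  have [->//|ln] := eqVneq (l n.+1) 0.
  have [_ e1 Te _] := pT n.+1; have [_ _ _ qT] := pT n.
  have := qT (e n.+1); rewrite e1// mulr1; apply: le_trans.
  apply: le_trans (qS _ _); rewrite /quad Te dotZl dotxx e1//.
  by rewrite Re_mul/= mul0r subr0 mulr1.
(* Once split off, e_k stays in the kernel: T m e_k = 0 gives l_m <e_k, e_m> = 0 by
   self-adjointness, so the next correction vanishes at e_k. Orthogonality follows in the same
   way. *)
have Tk k n : l k != 0 -> T (k + n.+1)%N (e k) = 0.
  move=> lk; elim: n => [|n IH].
    rewrite addn1 TS; have [_ e1 -> _] := pT k.
    by rewrite dotxx e1// mulr1 subrr.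
  rewrite addnS TS IH sub0r; apply/eqP; rewrite oppr_eq0; apply/eqP.
  set m := (k + n.+1)%N.
  have [_ _ Te _] := pT m.
  have : dot (T m (e k)) (e m) = 0 by rewrite IH dot0l.
  rewrite (positive_self_adjoint (linT m) (posT m)) Te dotZr conjc_real => ->.
  by rewrite scale0r.
have on : on_support dot l e.
  have lt i j : (i < j)%N -> l i != 0 -> l j != 0 -> dot (e i) (e j) = 0.
    move=> ij li lj; have [_ _ Te _] := pT j.
    have : dot (T j (e i)) (e j) = 0.
      by have := Tk i (j - i.+1)%N li; rewrite addnS -addSn subnKC// => ->; rewrite dot0l.
    rewrite (positive_self_adjoint (linT j) (posT j)) Te dotZr conjc_real.
    move=> /eqP; rewrite mulf_eq0 => /orP[|/eqP//].
    by move=> /eqP[lj0]; rewrite lj0 eqxx in lj.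
  move=> i j li lj; case: (ltngtP i j) => [ij|ij|->].
  - by rewrite lt.
  - by rewrite dotC lt// conjc0.
  - rewrite dotxx; by have [_ -> //] := pT j.
have Tpsum n x : T n x = A x - psum dot l e n x.
  elim: n => [|n IH]; first by rewrite psum0 subr0.
  by rewrite TS IH /psum big_ord_recr/= opprD addrA.
have trn n : (tr (T n) + (\sum_(i < n) l i)%:E = tr A)%E.
  elim: n => [|n IH]; first by rewrite big_ord0 adde0.
  rewrite -IH big_ord_recr/= [in RHS](tr_deflate (gT n) (pT n)).
  by rewrite -addeA -EFinD [l n + _]addrC.
exists l, e; split=> //; split=> // x.
have [bA pA trA] := gA.
have trT : tr A = (fine (tr A))%:E.
  rewrite fineK// ge0_fin_numE//.
  by apply: esum_ge0 => u _; rewrite lee_fin (positive_Re pA).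
have suml n : \sum_(i < n) l i <= fine (tr A).
  rewrite -lee_fin -trT -(trn n) leeDr//.
  by apply: esum_ge0 => u _; rewrite lee_fin (positive_Re (posT n)).
have mono n m : (n <= m)%N -> l m <= l n.
  by move=> /subnK <-; elim: (m - n)%N => [//|k IH]; rewrite addSn (le_trans (lS _)).
(* By monotonicity N l_N is at most the sum of the first N eigenvalues, hence at most the trace. *)
have small (d : R) : 0 < d -> exists N, l N < d.
  move=> d0; exists (Num.trunc (fine (tr A) / d)).+1; set N := _.+1.
  have : N%:R * l N <= fine (tr A).
    apply: le_trans (suml N).
    rewrite -[N in N%:R]card_ord -sum1_card natr_sum mulr_suml; apply: ler_sum => i _.
    by rewrite mul1r mono// ltnW.
  have NT : fine (tr A) / d < N%:R by exact: truncnS_gt.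
  rewrite ltr_pdivrMr// in NT => h.
  by rewrite -(@ltr_pM2l _ N%:R)//; exact: le_lt_trans NT.
have q0 n y : 0 <= quad (T n) y by exact: positive_Re.
have qA n y : quad (T n) y <= quad A y.
  by elim: n => [//|n IH]; exact: le_trans IH.
apply/(cvg_nqP hH)/cvgrPdist_lt => d d0.
have K0 : 0 < quad A x + 1 by rewrite ltr_wpDl//; exact: (q0 0%N).
have [N hN] := small (d / (quad A x + 1)) ltac:(by rewrite divr_gt0).
exists N => // n /= Nn.
rewrite -/(psum dot l e n x) nqBC -Tpsum sub0r normrN ger0_norm ?nq_ge0//.
have [_ _ _ qT] := pT n.
apply: le_lt_trans (positive_sqr_le (linT n) (posT n) x qT) _.
rewrite -/(quad _ _); rewrite ltr_pdivlMr// in hN.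
apply: le_lt_trans hN; apply: ler_pM => //; first exact: mono.
by rewrite (le_trans (qA n x))// lerDl.
Qed.

End Deflation.

(** * Operator order and absolute value *)

Section OperatorOrder.
Context {R : realType} {H : completeNormedModType R[i]}.
Variable dot : {dot H for (@Num.conj R[i])}.
Hypothesis hH : hilbert dot.
Local Notation nq := (nq dot).
Local Notation quad := (quad dot).
Implicit Types A B : H -> H.

(* A nonzero combination of e_0, ..., e_k is orthogonal to e'_0, ..., e'_(k-1). *)
Lemma weyl A B l e l' e' k : spectral_repr dot A l e -> spectral_repr dot B l' e' ->
  (forall n, 0 <= l n) -> (forall n, 0 <= l' n) ->
  {homo l : m n / (m <= n)%N >-> n <= m} ->
  {homo l' : m n / (m <= n)%N >-> n <= m} ->
  (forall x, quad A x <= quad B x) -> l k <= l' k.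
Proof.
move=> rA rB l0 l'0 lmono l'mono AB; rewrite leNgt; apply/negP => lt.
(* Since l k > l' k >= 0, no index up to k is padding, and e_0, ..., e_k are orthonormal. *)
have lk i : (i <= k)%N -> l i != 0.
  by move=> /lmono h; rewrite gt_eqF// (lt_le_trans _ h)// (le_lt_trans _ lt).
pose M : 'M[R[i]]_(k.+1, k) := \matrix_(i, j) dot (e i) (e' j).
have : kermx M != 0.
  rewrite kermx_eq0 -row_leq_rank -ltnNge ltnS; exact: rank_leq_col.
move=> /rowV0Pn[v /sub_kermxP vM v0].
pose c i : R[i] := if insub i is Some j then v 0 j else 0.
pose x := \sum_(i <- iota 0 k.+1) c i *: e i.
have one (i j : nat) : (i <= k)%N -> (j <= k)%N -> dot (e i) (e j) = (i == j)%:R.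
  by move=> /lk li /lk lj; exact: rA.1.
have sub i : i \in iota 0 k.+1 -> (i <= k)%N by rewrite mem_iota add0n ltnS.
have xe' j : (j < k)%N -> dot x (e' j) = 0.
  move=> jk; have := congr1 (fun w : 'rV_k => w 0 (Ordinal jk)) vM.
  rewrite !mxE => vj; rewrite -[RHS]vj /x dot_suml.
  have -> : iota 0 k.+1 = index_iota 0 k.+1 by [].
  rewrite big_mkord; apply: eq_bigr => i _.
  by rewrite dotZl !mxE /c valK.
have nqx : nq x = \sum_(i <- iota 0 k.+1) sqn (c i).
  by rewrite (on_nq_sum (P := fun i => (i <= k)%N) one)// iota_uniq.
have x0 : 0 < nq x.
  rewrite lt_neqAle nq_ge0 andbT eq_sym nqx; apply/eqP => s0.
  move/eqP: v0; apply; apply/rowP => i; rewrite mxE; apply: sqn_eq0.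
  have := s0; have -> : iota 0 k.+1 = index_iota 0 k.+1 by [].
  rewrite big_mkord => /eqP; rewrite psumr_eq0; last by move=> *; exact: sqn_ge0.
  by move=> /allP/(_ i (mem_index_enum _))/= /eqP; rewrite /c valK.
have qA : l k * nq x <= quad A x.
  rewrite -lee_fin -(repr_quad hH rA l0 x).
  apply: (@le_trans _ _ (\sum_(i < k.+1) l i * sqn (dot x (e i)))%:E); last first.
    by apply: esum_ge_ord => i; rewrite mulr_ge0 ?sqn_ge0.
  rewrite lee_fin nqx; have -> : iota 0 k.+1 = index_iota 0 k.+1 by [].
  rewrite big_mkord mulr_sumr; apply: ler_sum => i _.
  have ik : (i <= k)%N by rewrite -ltnS.
  rewrite (on_coord (P := fun i => (i <= k)%N) one) ?iota_uniq//.
  by rewrite mem_iota add0n ltn_ord ler_wpM2r ?sqn_ge0 ?lmono.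
have qB : quad B x <= l' k * nq x.
  rewrite -lee_fin -(repr_quad hH rB l'0 x); apply: esum_le_ord => [i|n].
    by rewrite mulr_ge0 ?sqn_ge0.
  have b : \sum_(i <- [seq i <- index_iota 0 n | l' i != 0]) sqn (dot x (e' i)) <= nq x.
    apply: (bessel (P := fun i => l' i != 0) rB.1).
      by rewrite filter_uniq// iota_uniq.
    by move=> i; rewrite mem_filter => /andP[].
  rewrite lee_fin; apply: le_trans (ler_wpM2l (l'0 k) b).
  rewrite big_filter mulr_sumr big_mkord [leRHS]big_mkcond.
  apply: ler_sum => i _; case: ifPn => [_|/negPn/eqP->]; last by rewrite mul0r.
  have [ik|ki] := ltnP i k; first by rewrite xe'// /sqn expr0n/= addr0 !mulr0.
  by rewrite ler_wpM2r ?sqn_ge0 ?l'mono.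
by have := le_trans qA (le_trans (AB x) qB); rewrite ler_pM2r// leNgt lt.
Qed.

Lemma bounded_quad A : bounded_op A ->
  exists2 K : R, 0 < K & forall x, `|quad A x| <= K * nq x.
Proof.
move=> /(bounded_op_le hH)[K K0 hK]; exists (K + 1) => [|x]; first by rewrite addr_gt0.
have := Re_dot_CS dot (A x) x; rewrite -/(quad A x) => h.
have n0 := nq_ge0 dot x.
rewrite -(@ler_pXn2r _ 2) ?nnegrE ?mulr_ge0 ?addr_ge0 ?(ltW K0)//.
rewrite real_normK ?num_real//; apply: (le_trans h).
apply: le_trans (ler_wpM2r n0 (hK x)) _.
rewrite exprMn -mulrA -expr2 ler_wpM2r ?sqr_ge0//; nra.
Qed.

Lemma quadB A B x : quad (fun x => A x - B x) x = quad A x - quad B x.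
Proof. by rewrite /quad dotBl Re_add Re_opp. Qed.

Lemma quadD A B x : quad (fun x => A x + B x) x = quad A x + quad B x.
Proof. by rewrite /quad dotDl Re_add. Qed.

Lemma quadZ (r : R) A x : quad (fun x => r%:C *: A x) x = r * quad A x.
Proof. by rewrite /quad dotZl Re_mul/= mul0r subr0. Qed.

(* Along unit vectors where B - A approaches its negative infimum mu,
   A x is close to B x - mu x, whose norm exceeds that of B x. *)
Lemma abs_dominates A B : bounded_op A -> bounded_op B -> positive_op dot B ->
  (forall x y, dot (A x) y = dot x (A y)) ->
  (forall x, nq (A x) = nq (B x)) -> forall x, quad A x <= quad B x.
Proof.
move=> bA bB pB sA AB x0; rewrite leNgt; apply/negP => lt0.
pose T x := B x - A x.
have qT x : quad T x = quad B x - quad A x by exact: quadB.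
have bT : bounded_op T by exact: bounded_opB.
have [K K0 hK] := bounded_quad bT.
have [KB KB0 hKB] := bounded_op_le hH bB.
have nrm x : nq x != 0 -> nq ((Num.sqrt (nq x))^-1%:C *: x) = 1.
  by move=> xn; rewrite nqZ sqnC exprVn sqr_sqrtr ?nq_ge0// mulVf.
have qZ (r : R) x : quad T (r%:C *: x) = r ^+ 2 * quad T x.
  rewrite /quad (opZ bT.1) dotZl dotZr mulrA mulJE sqnC.
  by rewrite Re_mul/= mul0r subr0.
pose Q := [set - quad T x | x in [set x | nq x = 1]].
have nx0 : nq x0 != 0.
  by apply/eqP => /nq_eq0 e; move: lt0; rewrite e /quad !dot0r ltxx.
have xp0 : 0 < nq x0 by rewrite lt_neqAle eq_sym nx0 nq_ge0.
have Q0 : Q !=set0 by eexists; exists ((Num.sqrt (nq x0))^-1%:C *: x0) => //; exact: nrm.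
have ubQ : ubound Q K.
  move=> _ [x /= x1 <-]; have := hK x; rewrite x1 mulr1; apply: le_trans.
  by rewrite -normrN ler_norm.
(* On unit vectors the form of B - A has infimum -m, so [T'], which is T + m, is positive. *)
pose m := sup Q.
have Tm x : - quad T x <= m * nq x.
  have [/nq_eq0->|xn] := eqVneq (nq x) 0; first by rewrite /quad dot0r nq0 mulr0 oppr0.
  have xp : 0 < nq x by rewrite lt_neqAle eq_sym xn nq_ge0.
  have : - quad T ((Num.sqrt (nq x))^-1%:C *: x) <= m.
    by apply: ub_le_sup; [exists K|exists ((Num.sqrt (nq x))^-1%:C *: x) => //; exact: nrm].
  by rewrite qZ exprVn sqr_sqrtr ?nq_ge0// -mulrN ler_pdivrMl// mulrC.
have m0 : 0 < m by have := Tm x0; rewrite qT; nra.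
pose T' x := T x + m%:C *: x.
have lT' : linear T'.
  by move=> a x y; rewrite /T' bT.1 !scalerDr !scalerA [m%:C * a]mulrC addrACA.
have sT x y : dot (T x) y = dot x (T y).
  by rewrite /T dotBl dotBr sA (positive_self_adjoint bB.1 pB).
have ImT x : Im (dot (T x) x) = 0.
  by have := congr1 (@complex.Im R) (dotC dot (T x) x); rewrite Im_conjc -sT => h; lra.
have qT' x : dot (T' x) x = (quad T x + m * nq x)%:C.
  rewrite /T' dotDl dotZl dotxx; apply: complex_eqP; rewrite !ReImE/=.
    by rewrite mul0r subr0.
  by rewrite ImT mulr0 mul0r !addr0.
have pT' : positive_op dot T'.
  by move=> x; rewrite qT' ler0c; have := Tm x; lra.
have nT' x : nq (T' x) <= (K + m) * (quad T x + m * nq x).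
  have := positive_sqr_le lT' pT' (K := K + m) x; rewrite qT'; apply => y.
  rewrite qT'/= mulrDl lerD2r; apply: le_trans (ler_norm _) (hK y).
pose C := 2 * KB + 2 * m ^+ 2.
have C0 : 0 < C by rewrite addr_gt0 ?mulr_gt0 ?exprn_gt0.
(* From A x = y - T' x, |A x| = |B x| and |y|^2 >= |B x|^2 + m^2 it follows that m^2 <= 2 Re <y, T'
   x>, hence m^4 <= 4 |y|^2 |T' x|^2 <= 4 C (K + m) d. This d makes the last term smaller than
   m^4. *)
pose d := m ^+ 4 / (4 * C * (K + m) + 4).
have Km0 : 0 < K + m by exact: addr_gt0.
have CK0 : 0 < C * (K + m) by exact: mulr_gt0.
have D0 : 0 < 4 * C * (K + m) + 4 by rewrite -mulrA; lra.
have d0 : 0 < d by rewrite divr_gt0 ?exprn_gt0.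
have [_ [x x1 <-] hx] := sup_adherent d0 (conj Q0 (ex_intro _ _ ubQ)).
rewrite -/m in hx; rewrite /= in x1.
have hT : nq (T' x) <= (K + m) * d.
  apply: le_trans (nT' x) _; rewrite ler_pM2l ?addr_gt0// x1; lra.
pose y := B x + m%:C *: x.
have Ay : A x = y - T' x.
  by rewrite /y /T' /T opprD addrACA opprB subrr addr0 addrC subrK.
have ny : nq (B x) + m ^+ 2 <= nq y.
  rewrite /y nqD nqZ sqnC x1 mulr1 dotZr conjc_real Re_mul/= mul0r subr0.
  rewrite lerD2r lerDl mulr_ge0// mulr_ge0 ?(ltW m0)//; exact: positive_Re.
have ny' : nq y <= C.
  apply: le_trans (nqD_le _ _ _) _; rewrite nqZ sqnC x1 mulr1 /C lerD2r.
  by rewrite ler_pM2l//; have := hKB x; rewrite x1 mulr1.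
have := AB x; rewrite Ay nqB => eqn.
have nn := nq_ge0 dot (T' x).
have hr : m ^+ 2 <= 2 * Re (dot y (T' x)) by lra.
have cs := Re_dot_CS dot y (T' x).
have cs' : Re (dot y (T' x)) ^+ 2 <= C * ((K + m) * d).
  apply: (le_trans cs); apply: ler_pM => //; exact: nq_ge0.
have m20 : 0 < m ^+ 2 by rewrite exprn_gt0.
have h4 : m ^+ 4 <= 4 * (C * ((K + m) * d)).
  rewrite (_ : m ^+ 4 = (m ^+ 2) ^+ 2); last by rewrite -exprM.
  apply: (@le_trans _ _ ((2 * Re (dot y (T' x))) ^+ 2)).
    by rewrite ler_pXn2r ?nnegrE ?(ltW m20)// (le_trans (ltW m20) hr).
  by rewrite exprMn -natrX ler_pM2l.
have dd : d * (4 * C * (K + m) + 4) = m ^+ 4 by rewrite /d divfK// gt_eqF.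
move: h4; rewrite -dd; lra.
Qed.

End OperatorOrder.

Section AbsoluteValue.
Context {R : realType} {H : completeNormedModType R[i]}.
Variable dot : {dot H for (@Num.conj R[i])}.
Hypothesis hH : hilbert dot.
Local Notation nq := (nq dot).
Local Notation quad := (quad dot).
Implicit Types A B : H -> H.

Lemma adjointE A : bounded_op A -> (forall x y, dot (A x) y = dot x (A y)) ->
  adjoint dot A = A.
Proof.
move=> bA sA; rewrite /adjoint.
set P := (X in xget _ X).
have PA : P A by split.
have [_ h] := xgetI (fun=> 0) PA.
apply/funext => x; apply/eqP; rewrite -subr_eq0; apply/eqP.
apply: (dot_eq0 (dot := dot)) => y.
by rewrite dotC dotBr -h sA subrr conjc0.
Qed.

Lemma sqrt_exists A (l : nat -> R) e : spectral_repr dot A l e ->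
  (forall n, 0 <= l n) -> (forall n, l n.+1 <= l n) ->
  exists B, [/\ bounded_op B, positive_op dot B & B \o B = A].
Proof.
move=> rA l0 lS; pose s n := Num.sqrt (l n).
have s0 n : 0 <= s n by exact: sqrtr_ge0.
have sn n : s n != 0 -> l n != 0.
  by apply: contra_neq => ln; rewrite /s ln sqrtr0.
have on : on_support dot s e.
  by move=> i j si sj; apply: rA.1; exact: sn.
have sK n : `|s n| <= s 0%N.
  rewrite ger0_norm// ler_wsqrtr//.
  by elim: n => [//|n]; apply: le_trans.
have [B rB] := spectral_repr_exists hH on sK.
exists B; split.
- exact: (repr_bounded hH rB sK).
- exact: (repr_positive hH rB s0).
apply/funext => x; rewrite /=.
have h1 := rB.2 (B x); have h2 := rA.2 x.
apply: (hcvg_unique h1); apply: cvg_trans h2.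
apply: near_eq_cvg; apply: nearW => n; apply: eq_bigr => i _.
have [si|si] := eqVneq (s i) 0.
  have -> : l i = 0 by rewrite -(sqr_sqrtr (l0 i)) -/(s i) si expr0n.
  by rewrite si !mul0r.
rewrite (repr_coord hH rB x si) mulrA -rmorphM/= -expr2.
by rewrite /s sqr_sqrtr.
Qed.

Variable E : set H.
Hypothesis bE : orthonormal_basis dot E.

Lemma good_sqr_bound A : good dot E A ->
  exists2 K : R, 0 <= K & forall x, nq (A x) <= K * quad A x.
Proof.
move=> gA; have [[M e] [M0 _ _ qA]] := top_pair_exists hH bE gA.
have [bA pA _] := gA; exists M => // x.
exact: (positive_sqr_le bA.1 pA).
Qed.

Lemma good_self_adjoint A : good dot E A -> forall x y, dot (A x) y = dot x (A y).
Proof. by move=> [[lA _] pA _]; exact: (positive_self_adjoint lA pA). Qed.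

Lemma good_comb A B (C D : R) (G : H -> H) : good dot E A -> good dot E B ->
  0 <= C -> 0 <= D -> bounded_op G -> positive_op dot G ->
  (forall x, quad G x <= C * quad A x + D * quad B x) -> good dot E G.
Proof.
move=> [bA pA tA] [bB pB tB] C0 D0 bG pG h; split=> //.
have qA0 x : 0 <= quad A x by exact: positive_Re.
have qB0 x : 0 <= quad B x by exact: positive_Re.
apply: (@le_lt_trans _ _ (C%:E * tr dot E A + D%:E * tr dot E B)%E); last first.
  have fin (A' : H -> H) : positive_op dot A' -> (tr dot E A' < +oo)%E ->
      tr dot E A' \is a fin_num.
    move=> pA' tA'; rewrite ge0_fin_numE//.
    by apply: esum_ge0 => u _; rewrite lee_fin (positive_Re pA').
  rewrite -(fineK (fin A pA tA)) -(fineK (fin B pB tB)) -!EFinM -EFinD; exact: ltry.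
rewrite /tr -(esum_mulr C0) -?(esum_mulr D0) -?esumD.
all: try by move=> u _; rewrite -?EFinM lee_fin ?mulr_ge0.
by apply: le_esum => u _; rewrite -!EFinM -EFinD lee_fin.
Qed.

(** A positive root of D^2 must exist for [abs_op] to be meaningful. The spectral theorem provides
    one because D^2 has finite trace: |D x|^2 <= 2 |A x|^2 + 2 |B x|^2, and each square is at most a
    multiple of the form of A or B. Whichever root is chosen, [abs_dominates] applies to it with D
    and with -D. *)
Lemma abs_opP A B : good dot E A -> good dot E B ->
  let D := fun x => A x - B x in
  [/\ bounded_op (abs_op dot D), positive_op dot (abs_op dot D) &
      forall x, `|quad D x| <= quad (abs_op dot D) x].
Proof.
move=> gA gB D; have [bA pA tA] := gA; have [bB pB tB] := gB.
have bD : bounded_op D by exact: bounded_opB.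
have sD x y : dot (D x) y = dot x (D y).
  by rewrite /D dotBl dotBr (good_self_adjoint gA) (good_self_adjoint gB).
have [KA KA0 hA] := good_sqr_bound gA; have [KB KB0 hB] := good_sqr_bound gB.
have gDD : good dot E (D \o D).
  apply: (good_comb gA gB (C := 2 * KA) (D := 2 * KB)); rewrite ?mulr_ge0//.
  - split; first by move=> a x y; rewrite /= bD.1 bD.1.
    by move=> x; apply: continuous_comp; exact: bD.2.
  - by move=> x; rewrite /= sD dotxx ler0c nq_ge0.
  - move=> x; rewrite {1}/quad/= sD -/(nq (D x)) /D.
    apply: le_trans (nqB_le _ _ _) _; rewrite -!mulrA.
    by apply: lerD; rewrite ler_pM2l.
have [m [e [rD m0 mS]]] := spectral_theorem hH bE gDD.
have ex : exists B0, [/\ bounded_op B0, positive_op dot B0 & B0 \o B0 = adjoint dot D \o D].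
  by rewrite adjointE//; exact: sqrt_exists rD m0 mS.
have := xgetPex (fun=> 0) ex; rewrite -/(abs_op dot D) adjointE//.
move=> [bB0 pB0 BD]; split=> // x.
have nqE y : nq (D y) = nq (abs_op dot D y).
  have /= BDy := congr1 (fun F => F y) BD.
  by rewrite /nq -sD -(positive_self_adjoint bB0.1 pB0) BDy.
rewrite ler_norml; apply/andP; split; last exact: (abs_dominates hH bD).
rewrite lerNl; pose D' x := (-1)%:C *: D x.
have -> : - quad D x = quad D' x by rewrite quadZ mulN1r.
apply: (abs_dominates hH) => //.
- exact: bounded_opZ.
- by move=> y z; rewrite /D' dotZl dotZr conjc_real sD.
- by move=> y; rewrite /D' nqZ sqnC sqrrN expr1n mul1r.
Qed.

End AbsoluteValue.

(** * Entropy of operators *)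

Section Entropy.
Context {R : realType} {H : completeNormedModType R[i]}.
Variable dot : {dot H for (@Num.conj R[i])}.
Hypothesis hH : hilbert dot.
Local Notation nq := (nq dot).
Local Notation quad := (quad dot).
Local Notation E := (xget set0 (orthonormal_basis dot)).
Implicit Types (A B : H -> H) (l : nat -> R).

Lemma eta_ge0 (x : R) : 0 <= x <= 1 -> 0 <= Defs.eta x.
Proof. by move=> /andP[x0 x1]; rewrite /Defs.eta -mulrN mulr_ge0// oppr_ge0 ln_le0. Qed.

Lemma eta_le1 (x : R) : 0 <= x -> Defs.eta x <= 1.
Proof.
move=> x0; have [->|xn] := eqVneq x 0; first by rewrite /Defs.eta mul0r oppr0.
have xp : 0 < x by rewrite lt_neqAle eq_sym xn.
rewrite /Defs.eta -mulrN -lnV ?posrE//.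
have := @ln_sublinear R x^-1; rewrite invr_gt0 => /(_ xp)/ltW/(ler_wpM2l x0).
by rewrite mulfV.
Qed.

(** The representation behind the operator chosen by [fun_op] need not be the given (l, e), which
    only serves to show that one exists. Sums are carried back to l by [spectral_repr_esum]. *)
Lemma fun_op_repr f A l e (K : R) : spectral_repr dot A l e -> f 0 = 0 ->
  (forall i, `|f (l i)| <= K) -> exists l' e',
  spectral_repr dot A l' e' /\ spectral_repr dot (fun_op dot f A) (f \o l') e'.
Proof.
move=> rA f0 fK.
have on : on_support dot (f \o l) e.
  by move=> i j /= fi fj; apply: rA.1; [move: fi|move: fj]; apply: contra_neq => ->.
have [B rB] := spectral_repr_exists hH on fK.
have ex : exists B l' e', spectral_repr dot A l' e' /\ spectral_repr dot B (f \o l') e'.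
  by exists B, l, e.
exact: (xgetPex (fun=> 0) ex).
Qed.

Hypothesis bE : orthonormal_basis dot E.

Lemma traceE A l e : spectral_repr dot A l e -> (forall i, 0 <= l i) ->
  trace dot A = \esum_(i in [set: nat]) (l i)%:E.
Proof. by move=> rA l0; exact: (repr_trace hH rA l0 bE). Qed.

Lemma repr_scale A l e (c : R) : c != 0 -> spectral_repr dot A l e ->
  spectral_repr dot (fun x => c%:C *: A x) (fun i => c * l i) e.
Proof.
move=> c0 rA; split.
  by move=> i j; rewrite !mulf_eq0 !negb_or => /andP[_ li] /andP[_ lj]; exact: rA.1.
move=> x; have := rA.2 x => /(cvgZr (k := c%:C)).
apply: cvg_trans; apply: near_eq_cvg; apply: nearW => n /=.
rewrite scaler_sumr; apply: eq_bigr => i _.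
by rewrite scalerA mulrA rmorphM.
Qed.

Lemma repr_ge0 A l e l' e' : spectral_repr dot A l e -> (forall i, 0 <= l i) ->
  spectral_repr dot A l' e' -> forall i, 0 <= l' i.
Proof.
by move=> rA l0 rA'; exact: (repr_eigen_ge0 hH rA' (repr_positive hH rA l0)).
Qed.

(** Once the sum is carried back to the given eigenvalues, this is the identity t eta(l_i / t) = l_i
    (ln t - ln l_i). *)
Lemma entropyE A l e t : spectral_repr dot A l e -> sums_to l t ->
  entropy dot A = shannon t l.
Proof.
move=> rA lt; have l0 := lt.1; rewrite /entropy; case: asboolP => [A0|An].
  have lz i : l i = 0.
    apply/eqP; apply: contrapT => /negP li.
    have := repr_coord hH rA (e i) li; rewrite A0 dot0l (rA.1 i i li li) eqxx mulr1.
    by move=> [/esym /eqP]; rewrite (negPf li).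
  by rewrite /shannon esum1// => i _; rewrite lz shannon_term0.
have t0 : 0 < t.
  rewrite lt_neqAle (sums_to_ge0 lt) andbT eq_sym; apply/eqP => tz; apply: An.
  rewrite tz in lt; apply/funext => x; apply: (nq_eq0 (dot := dot)); apply/eqP.
  rewrite eq_le nq_ge0 andbT.
  have := @repr_nq_le _ _ _ hH _ _ _ rA 0 x; rewrite expr0n mul0r; apply => i.
  by rewrite (esum0_eq0 lt) normr0.
have trA : trace dot A = t%:E by rewrite (traceE rA l0) lt.2.
have tn : t != 0 by rewrite gt_eqF.
have rN := repr_scale (invr_neq0 tn) rA.
have n0 i : 0 <= t^-1 * l i by apply: mulr_ge0 => //; rewrite invr_ge0 ltW.
have n1 i : t^-1 * l i <= 1.
  by rewrite mulrC ler_pdivrMr// mul1r; exact: (sums_to_le i lt).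
have eta0 : Defs.eta (0 : R) = 0 by rewrite /Defs.eta mul0r oppr0.
have eta_bound i : `|Defs.eta (t^-1 * l i)| <= 1.
  by rewrite ger0_norm ?eta_le1 ?eta_ge0 ?n0 ?n1.
have [l' [e' [rN' rC]]] := fun_op_repr rN eta0 eta_bound.
have l'0 := repr_ge0 rN n0 rN'.
(* The chosen eigenvalues have the same sum as t^-1 l, by the case f = id of [spectral_repr_esum];
   so each is at most 1 and [eta] is nonnegative there. *)
have l'1 i : l' i <= 1.
  have s' : \esum_(i in [set: nat]) (l' i)%:E = 1%E.
    rewrite -(spectral_repr_esum hH (f := id) rN rN')//.
    under eq_esum do rewrite EFinM.
    rewrite esum_mulr ?lt.2 ?invr_ge0 ?(ltW t0)//; last by move=> *; rewrite lee_fin.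
    by rewrite -EFinM mulVf.
  exact: (@sums_to_le _ l' 1 i (conj l'0 s')).
have NE : normalized dot A = (fun x => t^-1%:C *: A x).
  by apply/funext => x; rewrite /normalized trA.
rewrite trA /state_entropy NE (traceE rC); last first.
  by move=> i; rewrite /= eta_ge0// l'0 l'1.
rewrite -(spectral_repr_esum hH (f := @Defs.eta R) rN rN')//; first last.
- by move=> i; rewrite eta_ge0// l'0 l'1.
- by move=> i; rewrite eta_ge0// n0 n1.
rewrite -esum_mulr ?(ltW t0)//; last by move=> i _; rewrite lee_fin eta_ge0// n0 n1.
apply: eq_esum => i _; rewrite -EFinM; congr (_%:E).
rewrite /Defs.eta /shannon_term; have [->|ln] := eqVneq (l i) 0.
  by rewrite mulr0 !mul0r oppr0 mulr0.
have lp : 0 < l i by rewrite lt_neqAle eq_sym ln l0.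
by rewrite [t^-1 * _]mulrC ln_div ?posrE//; field.
Qed.

(** Independence of the representation is used twice: for f, to obtain the mass s, and for x going
    to [shannon_term s (f x)], to obtain the entropy. *)
Lemma entropy_fun_op f A l e s t : spectral_repr dot A l e -> sums_to l t ->
  (forall x, 0 <= x -> 0 <= f x <= x) -> sums_to (f \o l) s ->
  entropy dot (fun_op dot f A) = shannon s (f \o l).
Proof.
move=> rA lt hf fs; have l0 := lt.1.
have f0 : f 0 = 0 by apply/eqP; rewrite eq_le andbC hf.
have ft i : `|f (l i)| <= t.
  have /andP[fi0 fi] := hf _ (l0 i).
  by rewrite ger0_norm// (le_trans fi)// (sums_to_le i lt).
have [l' [e' [rA' rC]]] := fun_op_repr rA f0 ft.
have l'0 := repr_ge0 rA l0 rA'.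
have fl i : 0 <= f (l i) by case/andP: (hf _ (l0 i)).
have fl' i : 0 <= f (l' i) by case/andP: (hf _ (l'0 i)).
have fs' : sums_to (f \o l') s.
  split=> //; rewrite -fs.2 /=; apply/esym.
  exact: (spectral_repr_esum hH (f := f) rA rA').
rewrite (entropyE rC fs') /shannon /=; apply/esym.
apply: (spectral_repr_esum hH (f := fun x => shannon_term s (f x)) rA rA') => //.
- by rewrite f0 shannon_term0.
- by move=> i; rewrite shannon_term_ge0// (sums_to_le i fs).
- by move=> i; rewrite shannon_term_ge0// (sums_to_le i fs').
Qed.

Lemma good_spectral A : good dot E A -> exists l e,
  [/\ spectral_repr dot A l e, sums_to l (fine (tr dot E A)) &
      {homo l : m n / (m <= n)%N >-> n <= m}].
Proof.
move=> gA; have [l [e [rA l0 lS]]] := spectral_theorem hH bE gA.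
exists l, e; split=> //.
  split=> //; rewrite -(traceE rA l0) fineK//; have [_ pA tA] := gA.
  by rewrite ge0_fin_numE//; apply: esum_ge0 => u _; rewrite lee_fin (positive_Re pA).
move=> m n /subnK <-; elim: (n - m)%N => [//|k IH].
by rewrite addSn (le_trans (lS _)).
Qed.

(* The dominating operator is (A + B + |A - B|) / 2. *)
Lemma state_common_majorant A B (eps : R) : good dot E A -> good dot E B ->
  trace dot A = 1%E -> trace dot B = 1%E ->
  ((2^-1)%:E * trace_norm dot (fun x => (A x - B x)%R) <= eps%:E)%E ->
  exists G, [/\ good dot E G, (tr dot E G <= (1 + eps)%:E)%E,
    forall x, quad A x <= quad G x & forall x, quad B x <= quad G x].
Proof.
move=> gA gB tA tB; rewrite /trace_norm; have [] := abs_opP hH bE gA gB.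
set D := abs_op dot _ => bD pD hD tD.
have [bA pA _] := gA; have [bB pB _] := gB.
pose G x := (2^-1)%:C *: (A x + B x + D x).
have qG x : quad G x = 2^-1 * (quad A x + quad B x + quad D x).
  by rewrite quadZ !quadD.
have trD0 : (0 <= tr dot E D)%E.
  by apply: esum_ge0 => u _; rewrite lee_fin (positive_Re pD).
have trG : (tr dot E G <= (1 + eps)%:E)%E.
  have -> : tr dot E G = ((2^-1)%:E * (tr dot E A + tr dot E B + tr dot E D))%E.
    rewrite /tr -!esumD; try by move=> u _; rewrite ?adde_ge0// lee_fin positive_Re.
    rewrite -esum_mulr ?invr_ge0//; last first.
      by move=> u _; rewrite !adde_ge0// lee_fin positive_Re.
    by apply: eq_esum => u _; rewrite qG.
  have -> : tr dot E A = 1%E by exact: tA.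
  have -> : tr dot E B = 1%E by exact: tB.
  rewrite ge0_muleDr ?adde_ge0//.
  rewrite EFinD leeD//; first by rewrite -EFinD -EFinM lee_fin; lra.
have bG : bounded_op G by apply: bounded_opZ; apply: bounded_opD => //; exact: bounded_opD.
have pG : positive_op dot G.
  move=> x; rewrite /G dotZl !dotDl mulr_ge0 ?addr_ge0 ?pA ?pB ?pD//.
  by rewrite ler0c invr_ge0.
exists G; split=> //.
- by split=> //; apply: le_lt_trans trG _; rewrite ltry.
- by move=> x; have := hD x; rewrite ler_norml quadB qG => /andP[]; lra.
- by move=> x; have := hD x; rewrite ler_norml quadB qG => /andP[]; lra.
Qed.

End Entropy.

(** * Reduction of the theorem to eigenvalue sequences *)

Lemma state_good (R : realType) (H : completeNormedModType R[i])
    (dot : {dot H for (@Num.conj R[i])}) (A : H -> H) : state dot A ->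
  good dot (xget set0 (orthonormal_basis dot)) A.
Proof.
by move=> [[bA _] pA tA]; split=> //; rewrite /tr -/(trace dot A) tA ltry.
Qed.

(* Without an orthonormal basis every trace would be an empty sum. *)
Lemma state_basis (R : realType) (H : completeNormedModType R[i])
    (dot : {dot H for (@Num.conj R[i])}) (A : H -> H) : state dot A ->
  orthonormal_basis dot (xget set0 (orthonormal_basis dot)).
Proof.
move=> [_ _]; rewrite /trace; case: xgetP => [E _ //|_].
by rewrite esum_set0 => -[] /eqP; rewrite eq_sym oner_eq0.
Qed.

Theorem proposition1 (R : realType) (H : completeNormedModType R[i])
    (dot : {dot H for (@Num.conj R[i])}) (hH : hilbert dot)
    (sepH : separable H) (rho : H -> H) (rhoS : state dot rho) :
  [/\ forall eps : R, 0 < eps <= 1 ->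
        (entropy dot (pos_part_sub dot rho eps) - (gfun eps)%:E
           <= LS dot rho eps)%E,
      (entropy dot rho < +oo)%E ->
        forall eps : R, 0 < eps <= 1 ->
        (entropy dot rho - entropy dot (min_op dot rho eps) - (gfun eps)%:E
           <= LS dot rho eps)%E,
      (entropy dot (pos_part_sub dot rho eps) - (gfun eps)%:E)%E
        @[eps --> (0 : R)^'+] --> entropy dot rho
    & (entropy dot rho < +oo)%E ->
      (entropy dot rho - entropy dot (min_op dot rho eps) - (gfun eps)%:E)%E
        @[eps --> (0 : R)^'+] --> entropy dot rho ].
Proof.
have bE := state_basis rhoS; have gR := state_good rhoS.
have state_spectral sigma : state dot sigma -> exists l e,
    [/\ spectral_repr dot sigma l e, sums_to l 1 &
      {homo l : m n / (m <= n)%N >-> n <= m}].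
  move=> sS; have [l [e [r s m]]] := good_spectral hH bE (state_good sS).
  exists l, e; split=> //; move: s; rewrite /tr -/(trace dot sigma).
  by case: sS => _ _ ->.
have [p [e [rp ps pm]]] := state_spectral _ rhoS.
have pE : entropy dot rho = shannon 1 p by exact: (entropyE hH bE rp ps).
have dom f : (forall x : R, 0 <= x -> 0 <= f x <= x) ->
    exists2 s, sums_to (f \o p) s & entropy dot (fun_op dot f rho) = shannon s (f \o p).
  move=> hf; have [i|s fs _] := @sums_to_dominated _ (f \o p) _ _ _ ps.
    exact: hf (ps.1 i).
  by exists s => //; exact: (entropy_fun_op hH bE rp ps hf fs).
(* The limits need the mass of the truncation as a function of eps on all of R; it is arbitrary for
   eps <= 0. *)
have /choice[s hs] : forall eps : R, exists s, 0 < eps -> sums_to (above eps p) s /\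
    entropy dot (pos_part_sub dot rho eps) = shannon s (above eps p).
  move=> eps; have [e0|] := ltrP 0 eps; last by exists 0.
  have [|s fs es] := dom (fun x => Num.max (x - eps) 0); last by exists s.
  by move=> x x0; rewrite le_max lexx orbT/= ge_max x0 lerBlDr lerDl ltW.
have /choice[t ht] : forall eps : R, exists t, 0 < eps -> sums_to (below eps p) t /\
    entropy dot (min_op dot rho eps) = shannon t (below eps p).
  move=> eps; have [e0|] := ltrP 0 eps; last by exists 0.
  have [|t ft et] := dom (fun x => Num.min x eps); last by exists t.
  by move=> x x0; rewrite le_min x0 (ltW e0)/= ge_min lexx.
(* All that (i) and (ii) need to know about the operators rho and sigma; what follows concerns
   sequences. *)
have near_state sigma eps : state dot sigma ->
    ((2^-1)%:E * trace_norm dot (fun x => (rho x - sigma x)%R) <= eps%:E)%E ->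
    exists q r T, [/\ entropy dot sigma = shannon 1 q, sums_to q 1, sums_to r T,
      T <= 1 + eps & (forall i, p i <= r i) /\ (forall i, q i <= r i)].
  move=> sS h; have [q [f [rq qs qm]]] := state_spectral _ sS.
  have trho : trace dot rho = 1%E by case: rhoS.
  have tsig : trace dot sigma = 1%E by case: sS.
  have [G [gG trG rG sG]] := state_common_majorant hH bE gR (state_good sS) trho tsig h.
  have [r [g [rr rs rm]]] := good_spectral hH bE gG.
  exists q, r, (fine (trace dot G)); split=> //.
  - exact: (entropyE hH bE rq qs).
  - by rewrite -lee_fin -rs.2 -(traceE hH bE rr rs.1).
  - split=> i; first exact: (weyl hH i rp rr ps.1 rs.1 pm rm rG).
    exact: (weyl hH i rq rr qs.1 rs.1 qm rm sG).
split.
- move=> eps /andP[e0 _]; have [xs ->] := hs eps e0.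
  apply: le_ereal_inf_tmp => _ [sigma [sS h] <-].
  have [q [r [T [-> qs rs Te [pr qr]]]]] := near_state _ _ sS h.
  rewrite leeBlDr//; apply: le_trans (shannon_truncated_le qs rs Te pr qr xs) _.
  by rewrite leeDl// lee_fin gfun_ge0// ltW.
- move=> pfin eps /andP[e0 _]; have [mt ->] := ht eps e0; rewrite pE in pfin *.
  apply: le_ereal_inf_tmp => _ [sigma [sS h] <-].
  have [q [r [T [-> qs rs Te [pr qr]]]]] := near_state _ _ sS h.
  (* Finiteness of the subtracted entropy, by monotonicity, is what allows it to be moved to the
     other side. *)
  have tfin : shannon (t eps) (below eps p) \is a fin_num.
    rewrite ge0_fin_numE ?shannon_ge0//; apply: le_lt_trans pfin.
    by apply: (shannon_mono _ mt ps) => i; rewrite /below/= ge_min lexx.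
  rewrite leeBlDr// leeBlDr// -addeA [X in (_ + X)%E]addeC addeA.
  exact: (shannon_min_le ps qs rs Te pr qr mt).
- rewrite pE; apply: cvg_trans (shannon_above_cvg ps (fun eps e0 => (hs eps e0).1)).
  apply: near_eq_cvg; near=> eps.
  by have [|_ ->] := hs eps.
- rewrite pE => pfin.
  apply: cvg_trans (shannon_below_cvg ps pfin (fun eps e0 => (hs eps e0).1)
    (fun eps e0 => (ht eps e0).1)).
  apply: near_eq_cvg; near=> eps.
  by have [|_ ->] := ht eps.
Unshelve. all: by end_near. Qed.
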